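(* Let $X=(X_i)_{i\in\mathbb{Z}}$ be a double-sided sequence of i.i.d. random variables with $P(X_i=\pm1)=\frac12$, and let, for each $n\in\mathbb{N}$, $(a_i^{(n)})_{i\in\mathbb{Z}}$ be a square-summable, not identically vanishing double-sided sequence of real numbers. Put $Y_i:=\frac12(1-X_i)$ for $i\in\mathbb{Z}$ and $$F_n:=\frac{G_n-\mathbb{E}G_n}{\sqrt{\mathrm{Var}\,G_n}},\qquad G_n:=\sum_{i\in\mathbb{Z}}a_i^{(n)}\,Y_iY_{i+1},\qquad n\in\mathbb{N}.$$ Let $N$ be a standard Gaussian random variable. Then $$d_K(F_n,N)\leq C\max\Big\{(\mathrm{Var}\,G_n)^{-3/2}\sum_{i\in\mathbb{Z}}|a_i^{(n)}|^3,\ (\mathrm{Var}\,G_n)^{-1}\Big(\sum_{i\in\mathbb{Z}}(a_i^{(n)})^4\Big)^{1/2}\Big\}$$ with a constant $0<C<\infty$ not depending on $n$.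
   Context: The Kolmogorov distance is $d_K(F,N)=\sup_{x\in\mathbb{R}}|P(F\le x)-P(N\le x)|$. The centred variable $G_n-\mathbb{E}G_n$ is understood as the $L^2$-convergent series $\sum_{i\in\mathbb{Z}}a_i^{(n)}(Y_iY_{i+1}-\frac14)$, and $\mathrm{Var}\,G_n=\frac{3}{16}\sum_{i\in\mathbb{Z}}(a_i^{(n)})^2+\frac18\sum_{i\in\mathbb{Z}}a_i^{(n)}a_{i+1}^{(n)}$ is its variance. *)

(* Defs.v *)
From HB Require Import structures.
From mathcomp Require Import all_boot all_order all_algebra.
From mathcomp Require Import all_classical all_reals all_analysis.

Set Implicit Arguments.
Unset Strict Implicit.
Unset Printing Implicit Defensive.

Import Order.TTheory GRing.Theory Num.Theory.
Import numFieldTopology.Exports numFieldNormedType.Exports.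

Local Open Scope classical_set_scope.
Local Open Scope ring_scope.

Definition mutually_independent (d : measure_display) (T : measurableType d)
    (R : realType) (P : probability T R) (I : eqType)
    (X : I -> {RV P >-> R}) : Prop :=
  forall (J : seq I) (B : I -> set R), uniq J ->
    (forall i, measurable (B i)) ->
    P (\bigcap_(i in [set` J]) (X i @^-1` B i)) =
      (\prod_(i <- J) P (X i @^-1` B i))%E.

(* The common law is prescribed, so identical distribution is automatic. *)
Definition iid_rademacher (d : measure_display) (T : measurableType d)
    (R : realType) (P : probability T R) (I : eqType)
    (X : I -> {RV P >-> R}) : Prop :=
  mutually_independent X /\
  forall i, P [set t | X i t = 1] = (2^-1)%:E /\
            P [set t | X i t = -1] = (2^-1)%:E.

(* The law is compared on measurable sets only: an abstract probability is
   unspecified on the others. *)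
Definition standard_gaussian (d : measure_display) (T : measurableType d)
    (R : realType) (Q : probability T R) (N : {RV Q >-> R}) : Prop :=
  forall A : set R, measurable A -> distribution Q N A = normal_prob 0 1 A.

Definition square_summable (R : realType) (a : int -> R) : Prop :=
  (\esum_(i in [set: int]) (a i ^+ 2)%:E < +oo)%E.

(* The index k stands for i = k - p, so that i runs through -p, ..., q. *)
Definition bilateral_partial_sum (T : Type) (R : realType)
    (u : int -> T -> R) (p q : nat) (t : T) : R :=
  \sum_(k < (p + q).+1) u (k%:Z - p%:Z) t.

(* S = \sum_(i in Z) u i in L^2(P), both ends of the partial sums going to
   infinity independently; this determines S up to P-null sets. *)
Definition is_L2_bilateral_sum (d : measure_display) (T : measurableType d)
    (R : realType) (P : probability T R) (u : int -> T -> R)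
    (S : {RV P >-> R}) : Prop :=
  (fun pq : nat * nat =>
     'N[P]_2%:E[EFin \o (fun t =>
       (S t - bilateral_partial_sum u pq.1 pq.2 t)%R)]%E)
    @ filter_prod \oo \oo --> 0%E.

(* F and N may live on different probability spaces. *)
Definition kolmogorov_distance (d d' : measure_display)
    (T : measurableType d) (T' : measurableType d') (R : realType)
    (P : probability T R) (Q : probability T' R)
    (F : T -> R) (N : T' -> R) : \bar R :=
  ereal_sup [set (`|P [set t | (F t <= x)%R] - Q [set t | (N t <= x)%R]|)%E
            | x in [set: R]].

Definition Y (d : measure_display) (T : measurableType d) (R : realType)
    (P : probability T R) (X : int -> {RV P >-> R}) (i : int) (t : T) : R :=
  2^-1 * (1 - X i t).

Definition centred_summand (d : measure_display) (T : measurableType d)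
    (R : realType) (P : probability T R) (X : int -> {RV P >-> R})
    (a : int -> R) (i : int) (t : T) : R :=
  a i * (Y X i t * Y X (i + 1) t - 4^-1).

Definition centred_over_sd (d : measure_display) (T : measurableType d)
    (R : realType) (P : probability T R) (H : {RV P >-> R}) (t : T) : R :=
  H t / Num.sqrt (fine 'V_P[H]).

(* Main.v *)
Require Import Defs.
From HB Require Import structures.
From mathcomp Require Import all_boot all_order all_algebra.
From mathcomp Require Import all_classical all_reals all_analysis.
From mathcomp Require Import measurable_realfun.
From mathcomp Require Import ring lra zify.

(* Stein's method with discrete integration by parts on the Rademacher signs.
   Since 16 V >= sum a_i^2, Cauchy-Schwarz makes the second entry of the maximum
   dominate the first up to a constant, so only C V^-1 (sum a_i^4)^(1/2) has to
   be reached.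

   A finite partial sum is F = sum_k X_k u_k with u_k free of X_k. Writing D_k
   for the discrete gradient, E[F g(F)] = sum_k E[u_k D_k g(F)]. For the solution
   g of Stein's equation for the indicator of ]-oo, x], D_k g(F) = g'(F) D_k F
   plus a remainder made of two parts: a Taylor part of order
   (D_k F)^2 (|F| + 1), and a jump part bounded by |D_k F| when the flip of X_k
   moves F across x. The jump indicator times |D_k F| equals D_k F times the
   discrete gradient of the indicator of {F > x}; integrating by parts once more
   turns the sum of the jump parts into a covariance with
   sum_k |u_k| (D_k F) X_k, whose L2 norm is O((sum a_i^4)^(1/2)) because it is a
   short Walsh sum. The same orthogonality controls sum_k u_k D_k F - V. The
   general case follows by L2 approximation and continuity of the normal
   distribution function. *)

Import Order.TTheory GRing.Theory Num.Theory.
Import numFieldTopology.Exports numFieldNormedType.Exports.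

Local Open Scope classical_set_scope.
Local Open Scope ring_scope.

(** * Stein's equation *)

(** The endpoints come in either order, since flipping a sign may move the form up or down. *)
Lemma mean_value (R : realType) (f df : R -> R) (a b : R) :
  (forall x : R, is_derive x 1 f (df x)) ->
  exists c, [/\ Num.min a b <= c, c <= Num.max a b &
    f b - f a = df c * (b - a)].
Proof.
move=> fdf; have fc : continuous f.
  move=> x; apply: differentiable_continuous; apply/derivable1_diffP.
  by have [] := fdf x.
wlog ab : a b / a <= b.
  move=> H; have [/H//|/H[c [c1 c2 e]]] := orP (le_total a b).
  exists c; rewrite minC maxC; split => //.
  by rewrite -opprB e -mulrN opprB.
have fdf' x : x \in `]a, b[ -> is_derive x 1 f (df x) by [].
have [c] := MVT_segment ab fdf' (continuous_subspaceT fc).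
rewrite in_itv/= => /andP[c1 c2] e; exists c; split => //.
- by rewrite (min_idPl ab).
- by rewrite (max_idPr ab).
Qed.

Section stein_equation.
Context {R : realType}.
(** [phi] and [Phi] stand for the Gaussian density and distribution function. The construction rests
    on [phi' = - w * phi], a lower bound [m] on [-1, 1] and the behaviour of [Phi] at both
    infinities. *)
Variables (phi Phi : R -> R) (m : R).
Hypothesis m0 : 0 < m.
Hypothesis phi_gt0 : forall w, 0 < phi w.
Hypothesis phi_ge : forall w, `|w| <= 1 -> m <= phi w.
Hypothesis phi' : forall w : R, is_derive w 1 phi (- w * phi w).
Hypothesis Phi' : forall w : R, is_derive w 1 Phi (phi w).
Hypothesis Phi01 : forall w, 0 <= Phi w <= 1.
Hypothesis Phi_Ny : forall M e : R, 0 < e -> exists2 t, t <= M & Phi t < e.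
Hypothesis Phi_y : forall M e : R, 0 < e -> exists2 t, M <= t & 1 - Phi t < e.

Let Phi_nd (a b : R) : a <= b -> Phi a <= Phi b.
Proof.
move=> ab; have [c [_ _ e]] := @mean_value R Phi phi a b Phi'.
by rewrite -subr_ge0 e mulr_ge0 ?subr_ge0// ltW.
Qed.

(** On ]-oo, w] the function [Phi t + phi t / w] has derivative [(w - t) / w * phi t], which is
    nonpositive; far to the left its values are at most [Phi t], hence below any [e > 0]. *)
Lemma mills_lower (w : R) : w < 0 -> - w * Phi w <= phi w.
Proof.
move=> w0; rewrite -ler_pdivlMl ?oppr_gt0//.
apply/ler_addgt0Pr => e e0; have [t tw Pt] := Phi_Ny w e e0.
pose k t := Phi t + w^-1 * phi t.
have k' (x : R) : is_derive x 1 k (phi x + w^-1 * (- x * phi x)).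
  have := phi' x; have := Phi' x => ? ?.
  by rewrite /k; apply: is_derive_eq.
have [c [_ + E]] := @mean_value R k _ t w k'.
rewrite (max_idPr tw) => cw.
have kwt : k w <= k t.
  rewrite -subr_le0 E mulr_le0_ge0 ?(subr_ge0 t)//.
  have -> : phi c + w^-1 * (- c * phi c) = (w - c) / w * phi c.
    by field; rewrite lt_eqF.
  by rewrite mulr_le0_ge0 ?(ltW (phi_gt0 _))// mulr_ge0_le0 ?subr_ge0// invr_le0 ltW.
have wt : w^-1 * phi t <= 0.
  by rewrite mulr_le0_ge0 ?invr_le0 ?(ltW w0) ?(ltW (phi_gt0 _)).
by move: kwt wt; rewrite /k invrN mulNr; lra.
Qed.

(** Mirror argument: [- Phi t - phi t / w] is nondecreasing on [w, +oo[. *)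
Lemma mills_upper (w : R) : 0 < w -> w * (1 - Phi w) <= phi w.
Proof.
move=> w0; rewrite -ler_pdivlMl//.
apply/ler_addgt0Pr => e e0; have [t wt Pt] := Phi_y w e e0.
pose k t := - Phi t - w^-1 * phi t.
have k' (x : R) : is_derive x 1 k (- phi x - w^-1 * (- x * phi x)).
  have := phi' x; have := Phi' x => ? ?.
  by rewrite /k; apply: is_derive_eq.
have [c [+ _ E]] := @mean_value R k _ w t k'.
rewrite (min_idPl wt) => wc.
have kwt : k w <= k t.
  rewrite -subr_ge0 E mulr_ge0 ?(subr_ge0 w)//.
  have -> : - phi c - w^-1 * (- c * phi c) = (c - w) / w * phi c.
    by field; rewrite gt_eqF.
  by rewrite mulr_ge0 ?(ltW (phi_gt0 _))// divr_ge0 ?subr_ge0// ltW.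
have wt' : 0 <= w^-1 * phi t.
  by rewrite mulr_ge0 ?invr_ge0 ?(ltW w0) ?(ltW (phi_gt0 _)).
by move: kwt wt'; rewrite /k; lra.
Qed.

(* [h] dominates the Stein solutions for all thresholds simultaneously. *)
Let h (w : R) := Phi w * (1 - Phi w) / phi w.
Let K := 1 + m^-1.

Let h_ge0 w : 0 <= h w.
Proof.
have /andP[P0 P1] := Phi01 w.
by rewrite divr_ge0 ?mulr_ge0 ?subr_ge0// ltW.
Qed.

Let h_abs (w : R) : `|w| * h w <= 1.
Proof.
have /andP[P0 P1] := Phi01 w.
rewrite /h mulrA ler_pdivrMr// mul1r.
have [w0|w0|->] := ltgtP w 0; last by rewrite normr0 mul0r ltW.
- rewrite ltr0_norm// mulrA; apply: le_trans (mills_lower w w0).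
  by rewrite ler_piMr; nra.
- rewrite gtr0_norm//; apply: le_trans (mills_upper w w0).
  by rewrite ler_pM2l//; nra.
Qed.

(** For [|w| <= 1] the lower bound on [phi] gives [m^-1]; for larger [|w|] the Mills bound [h_abs]
    gives 1. [K] covers both cases. *)
Let h_le w : h w <= K.
Proof.
have [w1|w1] := leP `|w| 1.
  have /andP[P0 P1] := Phi01 w.
  rewrite /h /K ler_pdivrMr// mulrDl mul1r.
  have := phi_ge w w1; have := phi_gt0 w => p0 mp.
  have : 1 <= m^-1 * phi w by rewrite ler_pdivlMl ?mulr1.
  by nra.
have := h_abs w; have := h_ge0 w => h0 h1.
have : 0 < m^-1 by rewrite invr_gt0.
by rewrite /K; nra.
Qed.

Section fixed_x.
Variable x : R.

(** The two branches of the bounded Stein solution, left and right of [x]. Each is smooth on the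
    whole line and solves [g' = w * g + e] with a constant [e]; they agree at [x]. *)
Let fl (w : R) := Phi w * (1 - Phi x) / phi w.
Let fr (w : R) := Phi x * (1 - Phi w) / phi w.

Let fl' (w : R) : is_derive w 1 fl (w * fl w + (1 - Phi x)).
Proof.
have := phi' w; have := Phi' w => ? ?.
have p0 := phi_gt0 w.
have ? : is_derive w 1 (fun w => (phi w)^-1) (- (phi w) ^- 2 *: (- w * phi w)).
  by apply: is_deriveV; rewrite gt_eqF.
rewrite /fl; apply: is_derive_eq.
rewrite /GRing.scale/=; field; by rewrite gt_eqF.
Qed.

Let fr' (w : R) : is_derive w 1 fr (w * fr w - Phi x).
Proof.
have := phi' w; have := Phi' w => ? ?.
have p0 := phi_gt0 w.
have ? : is_derive w 1 (fun w => (phi w)^-1) (- (phi w) ^- 2 *: (- w * phi w)).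
  by apply: is_deriveV; rewrite gt_eqF.
rewrite /fr; apply: is_derive_eq.
rewrite /GRing.scale/=; field; by rewrite gt_eqF.
Qed.

(** On its own side of [x] each branch lies below [h], by monotonicity of [Phi]; the bounds are
    those of [h] and so do not depend on [x]. *)
Let branch_bounds f (w : R) : f = fl /\ w <= x \/ f = fr /\ x <= w ->
  [/\ 0 <= f w, f w <= K & `|w| * f w <= 1].
Proof.
move=> H; have /andP[P0 P1] := Phi01 w; have /andP[Q0 Q1] := Phi01 x.
have p0 := phi_gt0 w.
have fw0 : 0 <= f w.
  by case: H => -[-> _]; rewrite divr_ge0 ?mulr_ge0 ?subr_ge0// ltW.
have fh : f w <= h w.
  case: H => -[-> H]; have HP := Phi_nd _ _ H;
  by rewrite ler_pdivrMr// divfK ?gt_eqF//; nra.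
split => //; first exact: le_trans fh (h_le w).
by apply: le_trans (h_abs w); rewrite ler_wpM2l.
Qed.

Let f (w : R) := if w <= x then fl w else fr w.
(** Read off from Stein's equation rather than obtained by differentiation: at the kink [x] this
    selects the left derivative. *)
Let f' (w : R) := w * f w + (w <= x)%R%:R - Phi x.

(** The mean value theorem turns the increment into [(v - w) * (c * g c + e)], and
    [c * g c - w * g w] splits as [(c - w) * g c + w * (g c - g w)]. Only the bound [K] on [g] and
    its Lipschitz constant 2 enter, not a second derivative. *)
Let taylor_branch (g : R -> R) (e w v : R) :
  (forall c : R, is_derive c 1 g (c * g c + e)) -> `|e| <= 1 ->
  (forall c, Num.min w v <= c <= Num.max w v ->
     [/\ 0 <= g c, g c <= K & `|c| * g c <= 1]) ->
  `|g v - g w| <= 2 * `|v - w| /\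
  `|g v - g w - (v - w) * (w * g w + e)| <=
     (2 * `|w| + K) * (v - w) ^+ 2.
Proof.
move=> g' e1 gb.
have lip a b : Num.min w v <= Num.min a b -> Num.max a b <= Num.max w v ->
    `|g b - g a| <= 2 * `|b - a|.
  move=> H1 H2; have [c [c1 c2 ->]] := @mean_value R g _ a b g'.
  rewrite normrM ler_wpM2r//.
  have [|g0 gK cg] := gb c.
    by rewrite (le_trans H1 c1) (le_trans c2 H2).
  rewrite (le_trans (ler_normD _ _))// normrM (ger0_norm g0).
  by rewrite (_ : 2 = 1 + 1)// lerD.
split; first exact: lip.
have [c [c1 c2 E]] := @mean_value R g _ w v g'.
have -> : g v - g w - (v - w) * (w * g w + e) =
   (v - w) * ((c - w) * g c + w * (g c - g w)).
  by rewrite E; ring.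
have cw : `|c - w| <= `|v - w|.
  have [wv|vw] := orP (le_total w v).
    move: c1 c2; rewrite (min_idPl wv) (max_idPr wv) => c1 c2.
    by rewrite !ger0_norm ?subr_ge0// lerD2r.
  move: c1 c2; rewrite (min_idPr vw) (max_idPl vw) => c1 c2.
  by rewrite !ler0_norm ?subr_le0// lerN2 lerD2r.
rewrite normrM -real_normK ?num_real// expr2 mulrCA ler_wpM2l//.
rewrite (le_trans (ler_normD _ _))// !normrM.
have [|g0 gK _] := gb c; first by rewrite c1 c2.
have H1 : `|c - w| * `|g c| <= `|v - w| * K by rewrite ler_pM// ger0_norm.
have H2 : `|w| * `|g c - g w| <= `|w| * (2 * `|v - w|).
  rewrite ler_wpM2l// (le_trans (lip w c _ _)) ?ler_wpM2l//.
  - by rewrite le_min ge_min lexx.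
  - by rewrite ge_max le_max lexx.
by apply: le_trans (lerD H1 H2) _; rewrite le_eqVlt; apply/orP; left; apply/eqP; ring.
Qed.

Let fl_bounds w v : w <= x -> v <= x -> forall c, Num.min w v <= c <= Num.max w v ->
  [/\ 0 <= fl c, fl c <= K & `|c| * fl c <= 1].
Proof.
move=> wx vx c /andP[_ cM]; apply: (branch_bounds fl c); left; split => //.
by rewrite (le_trans cM)// ge_max wx.
Qed.

Let fr_bounds w v : x <= w -> x <= v -> forall c, Num.min w v <= c <= Num.max w v ->
  [/\ 0 <= fr c, fr c <= K & `|c| * fr c <= 1].
Proof.
move=> wx vx c /andP[cm _]; apply: (branch_bounds fr c); right; split => //.
by rewrite (le_trans _ cm)// le_min wx.
Qed.

Let el : `|1 - Phi x| <= 1.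
Proof. by have := Phi01 x; rewrite ler_norml; lra. Qed.

Let er : `|- Phi x| <= 1.
Proof. by have := Phi01 x; rewrite ler_norml; lra. Qed.

Let f_bounded w : `|f' w| <= 2.
Proof.
have /andP[P0 P1] := Phi01 x.
rewrite /f' /f; have [wx|wx] := leP w x.
  have [|g0 _ g1] := branch_bounds fl w; first by left.
  rewrite -addrA (le_trans (ler_normD _ _))// normrM (ger0_norm g0).
  by rewrite (_ : 2 = 1 + 1)// lerD.
have [|g0 _ g1] := branch_bounds fr w; first by right; rewrite ltW.
rewrite addr0 (le_trans (ler_normD _ _))// normrM (ger0_norm g0).
by rewrite (_ : 2 = 1 + 1)// lerD.
Qed.

(** The branches meet at [x], which lies between [w] and [v], so the two Lipschitz bounds add up. *)
Let f_lip w v : w <= x -> x <= v -> `|fr v - fl w| <= 2 * `|v - w|.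
Proof.
move=> wx xv.
have [L _] := taylor_branch fl (1 - Phi x) w x fl' el (fl_bounds _ _ wx (lexx x)).
have [M _] := taylor_branch fr (- Phi x) x v fr' er (fr_bounds _ _ (lexx x) xv).
have -> : fr v - fl w = (fr v - fr x) + (fl x - fl w) by rewrite /fl /fr; ring.
rewrite (le_trans (ler_normD _ _))// (le_trans (lerD M L))//.
by rewrite !ger0_norm ?subr_ge0 ?(le_trans wx)//; lra.
Qed.

Let f_taylor w v :
  `|f v - f w - (v - w) * f' w| <= (2 * `|w| + K) * (v - w) ^+ 2
     + 4 * `|v - w| * ((w <= x) != (v <= x))%R%:R.
Proof.
have K0 : 0 <= K by rewrite addr_ge0// invr_ge0 ltW.
(* When [x] separates [w] from [v], no expansion is made: the increment and the linear term each
   cost [2 * |v - w|], whence the 4. *)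
have cross : `|f v - f w| <= 2 * `|v - w| ->
    `|f v - f w - (v - w) * f' w| <= (2 * `|w| + K) * (v - w) ^+ 2
     + 4 * `|v - w| * true%:R.
  move=> H; rewrite mulr1; apply: ler_wpDl.
    by rewrite mulr_ge0 ?sqr_ge0// addr_ge0// mulr_ge0.
  rewrite (le_trans (ler_normB _ _))// normrM.
  have := f_bounded w; have := normr_ge0 (v - w); have := normr_ge0 (f' w).
  by nra.
move: cross; rewrite {1 2 3}/f /f' /f.
have [wx|wx] := leP w x; have [vx|vx] := leP v x => /= cross.
- have [_] := taylor_branch fl (1 - Phi x) w v fl' el (fl_bounds _ _ wx vx).
  by rewrite mulr0 !addr0 addrA.
- by apply: cross; apply: f_lip => //; exact: ltW.
- apply: cross; rewrite distrC (distrC v); apply: f_lip => //; exact: ltW.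
- have [_] := taylor_branch fr (- Phi x) w v fr' er
    (fr_bounds _ _ (ltW wx) (ltW vx)).
  by rewrite mulr0 !addr0.
Qed.

Lemma stein_solution : exists g g' : R -> R,
  [/\ forall w, g' w - w * g w = (w <= x)%R%:R - Phi x,
      forall w, `|g' w| <= 2 &
      forall w v, `|g v - g w - (v - w) * g' w| <= (2 * `|w| + K) * (v - w) ^+ 2
        + 4 * `|v - w| * ((w <= x) != (v <= x))%R%:R].
Proof.
exists f, f'; split; [|exact: f_bounded|exact: f_taylor].
by move=> w; rewrite /f'; ring.
Qed.

End fixed_x.
End stein_equation.

(** * The standard normal distribution function and its Stein solutions *)

Section standard_normal.
Context {R : realType}.
Implicit Types w x : R.

Local Notation phi := (@normal_pdf R 0 1).

Definition normal_cdf (x : R) : R := fine (normal_prob 0 1 `]-oo, x]).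

Lemma normal_pdf01E w : phi w = normal_peak 1 * expR (- w ^+ 2 / 2).
Proof. by rewrite normal_pdfE ?oner_neq0// /normal_fun subr0 expr1n. Qed.

Lemma normal_pdf01_gt0 w : 0 < phi w.
Proof. by rewrite normal_pdf01E mulr_gt0 ?expR_gt0// normal_peak_gt0 ?oner_neq0. Qed.

Lemma normal_pdf01_ge w : `|w| <= 1 -> phi 1 <= phi w.
Proof.
move=> w1; rewrite !normal_pdf01E ler_wpM2l ?normal_peak_ge0// ler_expR.
rewrite ler_pM2r ?invr_gt0// lerN2 expr1n -real_normK ?num_real//.
by rewrite exprn_ile1.
Qed.

Lemma is_derive_normal_pdf01 w : is_derive w 1 phi (- w * phi w).
Proof.
have -> : phi = (fun w => normal_peak 1 * expR (- w ^+ 2 / 2)).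
  by apply/funext => ?; rewrite normal_pdf01E.
have H : is_derive w 1 (fun w : R => - w ^+ 2 / 2) (- w).
  by apply: is_derive_eq; rewrite /GRing.scale/=; field.
have H2 : is_derive w 1 (expR \o (fun w : R => - w ^+ 2 / 2))
   (- w * expR (- w ^+ 2 / 2)).
  by apply: is_derive_eq; rewrite /GRing.scale/=; ring.
rewrite mulrCA; exact: is_deriveZ.
Qed.

Lemma is_derive_normal_cdf w : is_derive w 1 normal_cdf (phi w).
Proof.
have c : continuous phi by apply: continuous_normal_pdf; exact: oner_neq0.
have ww : w < w + 1 by rewrite ltrDl.
have int : lebesgue_measure.-integrable [set` `]-oo, (w + 1)]] (EFin \o phi).
  apply: integrableS (integrable_normal_pdf 0 1) => //.
have [d e] := @continuous_FTC1 R phi -oo%O w _ ww int (ltNyr _) (c w).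
split => //; by rewrite -derive1E.
Qed.

Lemma normal_cdf01 w : 0 <= normal_cdf w <= 1.
Proof.
rewrite fine_ge0//= -[leRHS]/(fine 1%E) fine_le// ?fin_num_measure//.
exact: probability_le1.
Qed.

(** The identity, seen as a random variable under the normal law, has [normal_cdf] as its
    distribution function; the limits at both infinities are then those of any [cdf]. *)
Let idTR : measurableTypeR R -> R := idfun.

#[local] HB.instance Definition _ :=
  @isMeasurableFun.Build _ _ _ _ idTR (@measurable_id _ _ setT).

Let normal_cdfE : normal_cdf =
  fine \o cdf (idTR : {RV (normal_prob (0:R) 1) >-> R}).
Proof. by []. Qed.

Lemma cvg_normal_cdfNy : normal_cdf @ -oo --> (0:R).
Proof. by rewrite normal_cdfE; exact/fine_cvg/cvg_cdfNy0. Qed.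

Lemma cvg_normal_cdfy : normal_cdf @ +oo --> (1:R).
Proof. by rewrite normal_cdfE; exact/fine_cvg/cvg_cdfy1. Qed.

Lemma normal_stein : exists2 K, 0 < K & forall x, exists g g' : R -> R,
  [/\ forall w, g' w - w * g w = (w <= x)%R%:R - normal_cdf x,
      forall w, `|g' w| <= 2 &
      forall w v, `|g v - g w - (v - w) * g' w| <= (2 * `|w| + K) * (v - w) ^+ 2
        + 4 * `|v - w| * ((w <= x) != (v <= x))%R%:R].
Proof.
(* Here [m] is [phi 1], the minimum of the density on [-1, 1]. *)
exists (1 + (phi 1)^-1); first by rewrite addr_gt0// invr_gt0 normal_pdf01_gt0.
apply: stein_solution.
- exact: normal_pdf01_gt0.
- exact: normal_pdf01_gt0.
- exact: normal_pdf01_ge.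
- exact: is_derive_normal_pdf01.
- exact: is_derive_normal_cdf.
- exact: normal_cdf01.
- move=> M e e0; near (ninfty_nbhs R) => t; exists t.
    by near: t; apply: nbhs_ninfty_le; exact: num_real.
  near: t. have /cvgrPdist_lt/(_ _ e0) := cvg_normal_cdfNy.
  apply: filterS => t; rewrite sub0r normrN ger0_norm//.
  by have /andP[] := normal_cdf01 t.
- move=> M e e0; near (pinfty_nbhs R) => t; exists t.
    by near: t; apply: nbhs_pinfty_ge; exact: num_real.
  near: t. have /cvgrPdist_lt/(_ _ e0) := cvg_normal_cdfy.
  apply: filterS => t; rewrite ger0_norm// subr_ge0.
  by have /andP[] := normal_cdf01 t.
Unshelve. all: by end_near. Qed.

Lemma continuous_normal_cdf : continuous normal_cdf.
Proof.
move=> x; apply: differentiable_continuous; apply/derivable1_diffP.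
by have [] := is_derive_normal_cdf x.
Qed.

End standard_normal.

(** * Quadratic forms in independent signs *)

Section uniform_average.
Context {R : realFieldType} {O : finType}.
Implicit Types g h : O -> R.

(** Expectation under the uniform law, which keeps the discrete part of the argument free of measure
    theory. *)
Definition avg g : R := #|O|%:R^-1 * \sum_o g o.

Lemma eq_avg g h : g =1 h -> avg g = avg h.
Proof. by move=> gh; congr (_ * _); apply: eq_bigr. Qed.

Lemma avgD g h : avg (fun o => g o + h o) = avg g + avg h.
Proof. by rewrite /avg big_split mulrDr. Qed.

Lemma avgZ c g : avg (fun o => c * g o) = c * avg g.
Proof. by rewrite /avg -mulr_sumr mulrCA. Qed.

Lemma avgN g : avg (fun o => - g o) = - avg g.
Proof. by rewrite /avg sumrN mulrN. Qed.

Lemma avg_sum n (g : 'I_n -> O -> R) :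
  avg (fun o => \sum_(i < n) g i o) = \sum_(i < n) avg (g i).
Proof. by rewrite /avg exchange_big mulr_sumr. Qed.

Lemma avg_ge0 g : (forall o, 0 <= g o) -> 0 <= avg g.
Proof. by move=> g0; rewrite mulr_ge0 ?invr_ge0 ?ler0n// sumr_ge0. Qed.

Lemma le_avg g h : (forall o, g o <= h o) -> avg g <= avg h.
Proof. by move=> gh; rewrite ler_wpM2l ?invr_ge0 ?ler0n// ler_sum. Qed.

Lemma ler_norm_avg g : `|avg g| <= avg (fun o => `|g o|).
Proof.
rewrite /avg normrM ger0_norm ?invr_ge0 ?ler0n//.
by rewrite ler_wpM2l ?invr_ge0 ?ler0n// ler_norm_sum.
Qed.

Lemma avg_bij (f : O -> O) g : bijective f -> avg (fun o => g (f o)) = avg g.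
Proof. by move=> fb; rewrite /avg [in RHS](reindex f)//; exact: onW_bij. Qed.

Hypothesis O_gt0 : (0 < #|O|)%N.

Lemma avg_cst c : avg (fun=> c) = c.
Proof. by rewrite /avg sumr_const -[c *+ _]mulr_natl mulKf// pnatr_eq0 -lt0n. Qed.

(** The variance of [g] is nonnegative. *)
Lemma sqr_avg g : avg g ^+ 2 <= avg (fun o => g o ^+ 2).
Proof.
have : 0 <= avg (fun o => (g o - avg g) ^+ 2) by apply: avg_ge0 => o; exact: sqr_ge0.
have -> : avg (fun o => (g o - avg g) ^+ 2) =
    avg (fun o => g o ^+ 2 + ((- 2 * avg g) * g o + avg g ^+ 2)).
  by apply: eq_avg => o; ring.
by rewrite !avgD avgZ avg_cst; lra.
Qed.

Lemma avg_norm_le g b : 0 <= b -> avg (fun o => g o ^+ 2) <= b ^+ 2 ->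
  avg (fun o => `|g o|) <= b.
Proof.
move=> b0 gb; rewrite -(@ler_pXn2r _ 2)// ?nnegrE ?avg_ge0//.
apply: le_trans (sqr_avg _) _; apply: le_trans gb.
by apply: le_avg => o; rewrite real_normK ?num_real.
Qed.

Lemma avg_sqr_add3 g1 g2 g3 :
  avg (fun o => (g1 o + g2 o + g3 o) ^+ 2) <=
  3 * (avg (fun o => g1 o ^+ 2) + avg (fun o => g2 o ^+ 2) + avg (fun o => g3 o ^+ 2)).
Proof.
rewrite -!avgD -avgZ; apply: le_avg => o.
have := sqr_ge0 (g1 o - g2 o); have := sqr_ge0 (g1 o - g3 o).
by have := sqr_ge0 (g2 o - g3 o); nra.
Qed.

Lemma avg_orthonormal n (Z : nat -> O -> R) (p : nat -> R) :
  (forall i, (i < n)%N -> avg (fun o => Z i o ^+ 2) = 1) ->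
  (forall i j, (i < j < n)%N -> avg (fun o => Z i o * Z j o) = 0) ->
  avg (fun o => (\sum_(i < n) p i * Z i o) ^+ 2) = \sum_(i < n) p i ^+ 2.
Proof.
elim: n => [|n IH] Z1 Z0.
  by under eq_avg do rewrite big_ord0 expr0n; rewrite avg_cst big_ord0.
rewrite big_ord_recr/= -IH; last 2 first.
- by move=> i /ltnW; exact: Z1.
- by move=> i j /andP[ij /ltnW jn]; rewrite Z0// ij.
have -> : avg (fun o => (\sum_(i < n.+1) p i * Z i o) ^+ 2) =
  avg (fun o => (\sum_(i < n) p i * Z i o) ^+ 2 + (p n ^+ 2 * Z n o ^+ 2 +
     2 * p n * \sum_(i < n) p i * (Z i o * Z n o))).
  apply: eq_avg => o; rewrite big_ord_recr/=.
  have -> : \sum_(i < n) p i * (Z i o * Z n o) =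
      (\sum_(i < n) p i * Z i o) * Z n o.
    by rewrite mulr_suml; apply: eq_bigr => i _; rewrite mulrA.
  by ring.
rewrite !avgD !avgZ Z1// mulr1 avg_sum big1 ?mulr0 ?addr0// => i _.
by rewrite avgZ Z0 ?mulr0// ltn_ord/=.
Qed.

End uniform_average.

(** * Walsh sums and integration by parts over abstract signs *)

Section sign_system.
Context {R : realType} {O : finType}.
Variables (M : nat) (X : nat -> O -> R) (flip : nat -> O -> O).
Hypothesis O_gt0 : (0 < #|O|)%N.
Hypothesis flipK : forall k, involutive (flip k).
Hypothesis X_flip : forall k o, (k < M)%N -> X k (flip k o) = - X k o.
Hypothesis X_flip_neq : forall j k o, (j < M)%N -> (k < M)%N -> j != k ->
  X j (flip k o) = X j o.
Hypothesis X_sqr : forall k o, X k o ^+ 2 = 1.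

Lemma avg_flip k (g : O -> R) : avg (fun o => g (flip k o)) = avg g.
Proof. by apply: avg_bij; exact: inv_bij. Qed.

Lemma avg_odd k (g : O -> R) : (forall o, g (flip k o) = - g o) -> avg g = 0.
Proof.
move=> gN; have := avg_flip k g; under eq_avg do rewrite gN.
by rewrite avgN; lra.
Qed.

(** Flipping the sign [l j] makes [Z i * Z j] odd for every [i < j], so the [Z i] are
    orthonormal. *)
Lemma sqr_avg_signs n (Z : nat -> O -> R) (l : nat -> nat) (p : nat -> R) :
  (forall i o, Z i o ^+ 2 = 1) ->
  (forall j o, (j < n)%N -> Z j (flip (l j) o) = - Z j o) ->
  (forall i j o, (i < j < n)%N -> Z i (flip (l j) o) = Z i o) ->
  avg (fun o => (\sum_(i < n) p i * Z i o) ^+ 2) = \sum_(i < n) p i ^+ 2.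
Proof.
move=> Z1 Zodd Zev; apply: avg_orthonormal => // [i _|i j ij].
  by under eq_avg do rewrite Z1; rewrite avg_cst.
apply: (@avg_odd (l j)) => o; rewrite Zev// Zodd ?mulrN//.
by have /andP[] := ij.
Qed.

Lemma avg_sqr_single n a (p : nat -> R) : (n + a <= M)%N ->
  avg (fun o => (\sum_(i < n) p i * X (i + a)%N o) ^+ 2) = \sum_(i < n) p i ^+ 2.
Proof.
move=> nM; apply: (@sqr_avg_signs _ (fun i => X (i + a)%N) (fun j => j + a)%N) => //.
- by move=> j o jn; rewrite X_flip//; lia.
- by move=> i j o ij; rewrite X_flip_neq//; lia.
Qed.

Lemma avg_sqr_pair n a b (p : nat -> R) : (a < b)%N -> (n + b <= M)%N ->
  avg (fun o => (\sum_(i < n) p i * (X (i + a)%N o * X (i + b)%N o)) ^+ 2) =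
  \sum_(i < n) p i ^+ 2.
Proof.
move=> ab nM.
(* The larger index [j + b] of the [j]-th pair occurs in no earlier pair, as [a < b]. *)
apply: (@sqr_avg_signs _ (fun i o => X (i + a)%N o * X (i + b)%N o)
  (fun j => j + b)%N) => //.
- by move=> i o; rewrite exprMn !X_sqr mulr1.
- by move=> j o jn; rewrite (X_flip (j + b)) ?X_flip_neq ?mulrN//; lia.
- by move=> i j o ij; rewrite !X_flip_neq//; lia.
Qed.

(** * The quadratic form of a weighted path *)

Section quadratic_form.
Variables (n : nat) (b : nat -> R).
Hypothesis nM : (n.+2 <= M)%N.
Hypothesis b0 : b 0%N = 0.

(** [b k] weights the edge between vertices [k] and [k.+1]. The factor [u k] of [X k.+1] keeps only
    the edge to the right, so each product is counted once; the gradient [D k] sees both neighbours.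
    [c k] bounds both in absolute value. *)
Let s k := b k + b k.+1.
Let u k o := (- s k + b k.+1 * X k.+2 o) / 4.
Let D k o := u k o + b k * X k o / 4.
Let c k := (`|b k| + `|b k.+1|) / 2.

Definition quad_form o := \sum_(k < n) X k.+1 o * u k o.
(** Sum of the squared Walsh coefficients of the form. *)
Definition quad_form_var := \sum_(k < n) (s k ^+ 2 + b k.+1 ^+ 2) / 16.

Local Notation F := quad_form.
Local Notation V := quad_form_var.

Let u_flip k o : (k < n)%N -> u k (flip k.+1 o) = u k o.
Proof. by move=> kn; rewrite /u X_flip_neq//; lia. Qed.

Let D_flip k o : (k < n)%N -> D k (flip k.+1 o) = D k o.
Proof. by move=> kn; rewrite /D u_flip// X_flip_neq//; lia. Qed.

Let F_flip k o : (k < n)%N -> F o - F (flip k.+1 o) = 2 * (X k.+1 o * D k o).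
Proof.
move=> kn; rewrite /F -sumrB.
(* The sign [X k.+1] occurs in summand [k] as its factor and in summand [k - 1] inside [u]. *)
have E (j : 'I_n) : X j.+1 o * u j o - X j.+1 (flip k.+1 o) * u j (flip k.+1 o) =
   (if j == Ordinal kn then 2 * (X k.+1 o * u k o) else 0) +
   (if j.+1 == k then b k * X k o * X k.+1 o / 2 else 0).
  have [-> /=|jk] := eqVneq j (Ordinal kn).
    by rewrite u_flip// X_flip ?gtn_eqF//; [ring|lia].
  have {}jk : j != k :> nat by apply: contra jk => /eqP jk; apply/eqP/val_inj.
  have jn := ltn_ord j.
  rewrite (@X_flip_neq j.+1)//; try lia.
  have [jk1|jk1] := eqVneq j.+1 k.
    by rewrite /u -jk1 X_flip; [field|lia].
  by rewrite /u X_flip_neq; [ring|lia|lia|lia].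
under eq_bigr do rewrite E.
rewrite big_split/= -big_mkcond/= big_pred1_eq -big_mkcond/=.
(* Vertex 1 has no summand to its left; [b 0 = 0] removes the matching term of [D 0]. *)
case: k kn E => [|k] kn E.
  by rewrite big_pred0// /D b0; ring.
rewrite (big_pred1 (Ordinal (ltnW kn)))/=; last first.
  by move=> j /=; rewrite eqSS -val_eqE.
by rewrite /D; field.
Qed.

Let c_ge0 k : 0 <= c k. Proof. by rewrite divr_ge0 ?addr_ge0. Qed.

Let X_norm k o : `|X k o| = 1.
Proof.
by apply/eqP; rewrite -(@eqrXn2 _ 2)// real_normK ?num_real// X_sqr expr1n.
Qed.

Let b_le k : `|b k| <= 2 * c k.
Proof. by rewrite /c mulrC divfK// lerDl. Qed.

Let bS_le k : `|b k.+1| <= 2 * c k.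
Proof. by rewrite /c mulrC divfK// lerDr. Qed.

Let s_le k : `|s k| <= 2 * c k.
Proof. by rewrite /c mulrC divfK// ler_normD. Qed.

Let u_le k o : `|u k o| <= c k.
Proof.
rewrite /u normrM [X in _ * X]ger0_norm// ler_pdivrMr//.
rewrite (le_trans (ler_normD _ _))// normrN normrM X_norm mulr1.
by have := s_le k; have := bS_le k; lra.
Qed.

Let D_le k o : `|D k o| <= c k.
Proof.
rewrite /D /u -mulrDl normrM [X in _ * X]ger0_norm// ler_pdivrMr//.
rewrite (le_trans (ler_normD _ _))// (le_trans (lerD (ler_normD _ _) (lexx _)))//.
rewrite normrN !normrM !X_norm !mulr1 /s.
by rewrite (le_trans (lerD (lerD (ler_normD _ _) (lexx _)) (lexx _)))// /c; lra.
Qed.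

(** Walsh expansion: the constants add up to the variance, and the other terms are centred and
    orthogonal within each of the three families. *)
Let uD_walsh k o : u k o * D k o = (s k ^+ 2 + b k.+1 ^+ 2) / 16 +
  (- (s k * b k.+1 / 8) * X k.+2 o + - (s k * b k / 16) * X k o +
   (b k * b k.+1 / 16) * (X k o * X k.+2 o)).
Proof.
have -> : s k ^+ 2 + b k.+1 ^+ 2 = s k ^+ 2 + b k.+1 ^+ 2 * X k.+2 o ^+ 2.
  by rewrite X_sqr mulr1.
by rewrite /D /u; field.
Qed.

Let avgX k : (k < M)%N -> avg (X k) = 0.
Proof. by move=> kM; apply: (@avg_odd k) => o; exact: X_flip. Qed.

Let avgXX j k : (j < k < M)%N -> avg (fun o => X j o * X k o) = 0.
Proof.
move=> jkM; apply: (@avg_odd k) => o.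
by rewrite X_flip ?X_flip_neq ?mulrN//; lia.
Qed.

Let avg_uD : avg (fun o => \sum_(k < n) u k o * D k o) = V.
Proof.
rewrite avg_sum; apply: eq_bigr => k _; have kn := ltn_ord k.
under eq_avg do rewrite uD_walsh.
rewrite !avgD avg_cst// !avgZ !avgX ?avgXX; try lia.
by rewrite !mulr0 !addr0.
Qed.

(* [v k] does not involve the sign [X k.+1], so only the part of [g] that is odd
   under flipping that sign contributes. *)
Let avg_parts (g : O -> R) (v : nat -> O -> R) k : (k < n)%N ->
    (forall o, v k (flip k.+1 o) = v k o) ->
  avg (fun o => X k.+1 o * v k o * g o) =
  avg (fun o => v k o * (X k.+1 o * (g o - g (flip k.+1 o)) / 2)).
Proof.
move=> kn vf.
have E : avg (fun o => X k.+1 o * v k o * g o) =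
    avg (fun o => - (X k.+1 o * v k o * g (flip k.+1 o))).
  rewrite -(@avg_flip k.+1); apply: eq_avg => o.
  by rewrite vf X_flip; [ring|lia].
have -> : avg (fun o => v k o * (X k.+1 o * (g o - g (flip k.+1 o)) / 2)) =
   avg (fun o => 2^-1 * (X k.+1 o * v k o * g o) +
                 2^-1 * - (X k.+1 o * v k o * g (flip k.+1 o))).
  by apply: eq_avg => o; ring.
by rewrite avgD !avgZ -E; field.
Qed.

(** Integration by parts with [g = F], whose gradient is [D]. *)
Lemma avg_sqr_quad_form : avg (fun o => F o ^+ 2) = V.
Proof.
have -> : avg (fun o => F o ^+ 2) =
    avg (fun o => \sum_(k < n) X k.+1 o * u k o * F o).
  by apply: eq_avg => o; rewrite expr2 {1}/F mulr_suml.
rewrite -avg_uD !avg_sum; apply: eq_bigr => k _.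
rewrite avg_parts// => [|o]; last exact: u_flip.
apply: eq_avg => o; rewrite F_flip//.
have -> : X k.+1 o * (2 * (X k.+1 o * D k o)) / 2 = X k.+1 o ^+ 2 * D k o by field.
by rewrite X_sqr mul1r.
Qed.

Lemma avg_quad_form : avg F = 0.
Proof.
rewrite avg_sum big1// => k _; apply: (@avg_odd k.+1) => o.
by rewrite u_flip// X_flip ?mulNr//; have := ltn_ord k; lia.
Qed.

(** From here on the form has unit variance and [r] is the square root of the sum of fourth powers;
    rescaling [b] recovers the general case. *)
Variable r : R.
Hypothesis r0 : 0 <= r.
Hypothesis r_sqr : r ^+ 2 = \sum_(k < n.+1) b k ^+ 4.
Hypothesis V1 : V = 1.

Let sqr_le k y : `|y| <= 2 * c k -> y ^+ 2 <= 4 * c k ^+ 2.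
Proof.
move=> yc; rewrite -real_normK ?num_real//.
have -> : 4 * c k ^+ 2 = (2 * c k) ^+ 2 by ring.
by rewrite ler_pXn2r ?nnegrE ?mulr_ge0.
Qed.

(** Cancellation in [s k] is harmless: the variance also contains [b k.+1], and
    [b k = s k - b k.+1]. The comparison with 24 times the variance is termwise. *)
Let c2_sum : \sum_(k < n) c k ^+ 2 <= 24.
Proof.
suff : \sum_(k < n) c k ^+ 2 <= 24 * V by rewrite V1 mulr1.
rewrite mulr_sumr; apply: ler_sum => k _.
have -> : c k ^+ 2 = (`|b k| + `|b k.+1|) ^+ 2 / 4 by rewrite /c; field.
have -> : b k.+1 ^+ 2 = `|b k.+1| ^+ 2 by rewrite real_normK ?num_real.
have := ler_normB (s k) (b k.+1); rewrite /s addrK => H.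
have -> : (b k + b k.+1) ^+ 2 = `|b k + b k.+1| ^+ 2 by rewrite real_normK ?num_real.
have := normr_ge0 (b k); have := normr_ge0 (b k.+1).
have := normr_ge0 (b k + b k.+1); move: H.
move: `|b k + b k.+1| `|b k| `|b k.+1| => p q t H p0 t0 q0.
have H2 : (q + t) ^+ 2 <= (p + 2 * t) ^+ 2.
  by rewrite ler_pXn2r ?nnegrE ?addr_ge0 ?mulr_ge0//; lra.
have := sqr_ge0 (2 * p - t); have := sqr_ge0 p; have := sqr_ge0 t.
have -> : (2 * p - t) ^+ 2 = 4 * p ^+ 2 - 4 * (p * t) + t ^+ 2 by ring.
have E : (p + 2 * t) ^+ 2 = p ^+ 2 + 4 * (p * t) + 4 * t ^+ 2 by ring.
move: H2; rewrite E. lra.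
Qed.

(** Convexity of the fourth power bounds [c k ^+ 4] by the mean of two neighbouring fourth
    powers. *)
Let c4_sum : \sum_(k < n) c k ^+ 4 <= r ^+ 2.
Proof.
have H1 : \sum_(k < n) b k ^+ 4 <= r ^+ 2.
  by rewrite r_sqr big_ord_recr/= lerDl exprn_even_ge0.
have H2 : \sum_(k < n) b k.+1 ^+ 4 <= r ^+ 2.
  by rewrite r_sqr big_ord_recl/= lerDr exprn_even_ge0.
have : \sum_(k < n) c k ^+ 4 <= \sum_(k < n) (b k ^+ 4 + b k.+1 ^+ 4) / 2.
  apply: ler_sum => k _.
  have E y : y ^+ 4 = `|y| ^+ 4 :> R.
    have E4 z : z ^+ 4 = (z ^+ 2) ^+ 2 :> R by ring.
    by rewrite !E4 real_normK ?num_real.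
  rewrite (E (b k)) (E (b k.+1)) /c.
  have := normr_ge0 (b k); have := normr_ge0 (b k.+1).
  move: `|b k| `|b k.+1| => q t t0 q0.
  have H3 : ((q + t) / 2) ^+ 2 <= (q ^+ 2 + t ^+ 2) / 2.
    by have := sqr_ge0 (q - t); nra.
  have H4 : (((q + t) / 2) ^+ 2) ^+ 2 <= ((q ^+ 2 + t ^+ 2) / 2) ^+ 2.
    by rewrite ler_pXn2r ?nnegrE ?sqr_ge0// divr_ge0// addr_ge0// sqr_ge0.
  rewrite -(exprM _ 2 2) in H4; apply: le_trans H4 _.
  by have := sqr_ge0 (q ^+ 2 - t ^+ 2); nra.
by rewrite -mulr_suml big_split/=; lra.
Qed.

(* Cauchy-Schwarz, obtained by optimising [2 l c^3 <= l^2 c^2 + c^4] in [l]. *)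
Let c3_sum : \sum_(k < n) c k ^+ 3 <= 5 * r.
Proof.
set A := \sum_(k < n) c k ^+ 3.
have A0 : 0 <= A by apply: sumr_ge0 => k _; rewrite exprn_ge0.
have H l : 2 * l * A <= l ^+ 2 * 24 + r ^+ 2.
  have : 2 * l * A <= l ^+ 2 * (\sum_(k < n) c k ^+ 2) + \sum_(k < n) c k ^+ 4.
    rewrite /A !mulr_sumr -big_split/=; apply: ler_sum => k _.
    have := sqr_ge0 (c k * (l - c k)).
    have -> : (c k * (l - c k)) ^+ 2 =
      l ^+ 2 * c k ^+ 2 + c k ^+ 4 - 2 * l * c k ^+ 3 by ring.
    by rewrite subr_ge0.
  by have := ler_wpM2l (sqr_ge0 l) c2_sum; have := c4_sum; lra.
(* This [l] gives [A ^+ 2 <= 24 * r ^+ 2], and 24 is below the square of 5. *)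
have := H (A / 24) => HA.
rewrite -(@ler_pXn2r _ 2)// ?nnegrE ?mulr_ge0// exprMn.
by have := sqr_ge0 r; nra.
Qed.

(** The constant [c k] replaces [|u k|], so that [W] is a Walsh sum of degree at most two. *)
Let W o := \sum_(k < n) c k * (X k.+1 o * D k o).

(** Three orthogonal families with squared coefficients at most [c k ^+ 4 / 4]; the factor 3 for
    splitting the square makes 9/4, the square of 3/2. *)
Let avg_W : avg (fun o => `|W o|) <= 3 / 2 * r.
Proof.
apply: avg_norm_le => //; first by rewrite mulr_ge0.
have -> : avg (fun o => W o ^+ 2) = avg (fun o =>
    (\sum_(k < n) (- (c k * s k / 4)) * X (k + 1)%N o +
     \sum_(k < n) (c k * b k.+1 / 4) * (X (k + 1)%N o * X (k + 2)%N o) +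
     \sum_(k < n) (c k * b k / 4) * (X (k + 0)%N o * X (k + 1)%N o)) ^+ 2).
  apply: eq_avg => o; congr (_ ^+ 2); rewrite -!big_split; apply: eq_bigr => k _ /=.
  by rewrite addn0 addn1 addn2 /D /u; field.
apply: le_trans (avg_sqr_add3 _ _ _) _.
rewrite (@avg_sqr_single n 1 (fun k => - (c k * s k / 4))); last by lia.
rewrite (@avg_sqr_pair n 1 2 (fun k => c k * b k.+1 / 4))//; last by lia.
rewrite (@avg_sqr_pair n 0 1 (fun k => c k * b k / 4))//; last by lia.
have -> : (3 / 2 * r) ^+ 2 = 9 / 4 * r ^+ 2 by field.
rewrite -!big_split/= mulr_sumr; apply: le_trans (ler_wpM2l _ c4_sum) => //.
rewrite mulr_sumr; apply: ler_sum => k _.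
have := sqr_le _ _ (s_le k); have := sqr_le _ _ (b_le k); have := sqr_le _ _ (bS_le k).
have := sqr_ge0 (c k).
have -> : c k ^+ 4 = c k ^+ 2 * c k ^+ 2 by ring.
have -> : (- (c k * s k / 4)) ^+ 2 = c k ^+ 2 * s k ^+ 2 / 16 by field.
have -> : (c k * b k.+1 / 4) ^+ 2 = c k ^+ 2 * b k.+1 ^+ 2 / 16 by field.
have -> : (c k * b k / 4) ^+ 2 = c k ^+ 2 * b k ^+ 2 / 16 by field.
by nra.
Qed.

(** Subtracting 1 removes the constant Walsh terms, since the variance is 1; the three remaining
    families are estimated in L2. *)
Let avg_Gamma : avg (fun o => `|\sum_(k < n) u k o * D k o - 1|) <= 2 * r.
Proof.
apply: avg_norm_le => //; first by rewrite mulr_ge0.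
have -> : avg (fun o => (\sum_(k < n) u k o * D k o - 1) ^+ 2) = avg (fun o =>
    (\sum_(k < n) (- (s k * b k.+1 / 8)) * X (k + 2)%N o +
     \sum_(k < n) (- (s k * b k / 16)) * X (k + 0)%N o +
     \sum_(k < n) (b k * b k.+1 / 16) * (X (k + 0)%N o * X (k + 2)%N o)) ^+ 2).
  apply: eq_avg => o; congr (_ ^+ 2); rewrite -[X in _ - X]V1 /V -sumrB -!big_split.
  by apply: eq_bigr => k _ /=; rewrite addn0 addn2 uD_walsh; ring.
apply: le_trans (avg_sqr_add3 _ _ _) _.
rewrite (@avg_sqr_single n 2 (fun k => - (s k * b k.+1 / 8))); last by lia.
rewrite (@avg_sqr_single n 0 (fun k => - (s k * b k / 16))); last by lia.
rewrite (@avg_sqr_pair n 0 2 (fun k => b k * b k.+1 / 16))//; last by lia.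
have -> : (2 * r) ^+ 2 = 4 * r ^+ 2 by ring.
rewrite -!big_split/= mulr_sumr; apply: le_trans (ler_wpM2l _ c4_sum) => //.
rewrite mulr_sumr; apply: ler_sum => k _.
have := sqr_le _ _ (s_le k); have := sqr_le _ _ (b_le k); have := sqr_le _ _ (bS_le k).
have := sqr_ge0 (c k).
have -> : c k ^+ 4 = c k ^+ 2 * c k ^+ 2 by ring.
have -> : (- (s k * b k.+1 / 8)) ^+ 2 = s k ^+ 2 * b k.+1 ^+ 2 / 64 by field.
have -> : (- (s k * b k / 16)) ^+ 2 = s k ^+ 2 * b k ^+ 2 / 256 by field.
have -> : (b k * b k.+1 / 16) ^+ 2 = b k ^+ 2 * b k.+1 ^+ 2 / 256 by field.
have := sqr_ge0 (s k); have := sqr_ge0 (b k); have := sqr_ge0 (b k.+1).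
move: (c k ^+ 2) (s k ^+ 2) (b k ^+ 2) (b k.+1 ^+ 2) => C S B B' B'0 B0 S0 C0 B'C BC SC.
have H1 : S * B' <= (4 * C) * (4 * C) by rewrite ler_pM.
have H2 : S * B <= (4 * C) * (4 * C) by rewrite ler_pM.
have H3 : B * B' <= (4 * C) * (4 * C) by rewrite ler_pM.
by nra.
Qed.

Let avg_absF : avg (fun o => `|F o|) <= 1.
Proof. by apply: avg_norm_le => //; rewrite avg_sqr_quad_form V1 expr1n. Qed.

(** The constant collects 4 from [avg_Gamma], [20 + 10 * K] from the Taylor parts and 12 from the
    jump parts. *)
Lemma quad_form_stein_bound (K x Phix : R) (g g' : R -> R) : 0 <= K ->
  (forall w, g' w - w * g w = (w <= x)%R%:R - Phix) ->
  (forall w, `|g' w| <= 2) ->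
  (forall w v, `|g v - g w - (v - w) * g' w| <= (2 * `|w| + K) * (v - w) ^+ 2
        + 4 * `|v - w| * ((w <= x) != (v <= x))%R%:R) ->
  `|avg (fun o => (F o <= x)%R%:R) - Phix| <= (36 + 10 * K) * r.
Proof.
move=> K0 gE g'2 gT.
pose rem k o := g (F (flip k.+1 o)) - g (F o) -
  (F (flip k.+1 o) - F o) * g' (F o).
(* Stein's equation leaves the mean of [g' (F o) - F o * g (F o)]; each summand of [F] is integrated
   by parts and the gradient of [g] at [F] expanded to first order. *)
have -> : avg (fun o => (F o <= x)%R%:R) - Phix =
    avg (fun o => (1 - \sum_(k < n) u k o * D k o) * g' (F o)) +
    avg (fun o => \sum_(k < n) u k o * (X k.+1 o * rem k o / 2)).
  rewrite -{1}(avg_cst O_gt0 Phix) -avgN -avgD.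
  under eq_avg do rewrite -gE.
  rewrite avgD avgN.
  have -> : avg (fun o => F o * g (F o)) =
      avg (fun o => \sum_(k < n) X k.+1 o * u k o * g (F o)).
    by apply: eq_avg => o; rewrite {1}/F mulr_suml.
  have -> : avg (fun o => \sum_(k < n) X k.+1 o * u k o * g (F o)) =
      avg (fun o => \sum_(k < n) u k o * D k o * g' (F o) -
                    \sum_(k < n) u k o * (X k.+1 o * rem k o / 2)).
    rewrite avgD avgN !avg_sum -sumrB; apply: eq_bigr => k _.
    rewrite (@avg_parts (g \o F) u)//; last by move=> o; exact: u_flip.
    rewrite -avgN -avgD; apply: eq_avg => o /=.
    have -> : g (F o) - g (F (flip k.+1 o)) =
        (F o - F (flip k.+1 o)) * g' (F o) - rem k o by rewrite /rem; ring.
    rewrite F_flip//.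
    have -> : X k.+1 o * (2 * (X k.+1 o * D k o) * g' (F o) - rem k o) / 2 =
      X k.+1 o ^+ 2 * D k o * g' (F o) - X k.+1 o * rem k o / 2 by field.
    by rewrite X_sqr; ring.
  rewrite avgD avgN opprB addrCA addrC; congr (_ + _).
  by rewrite -avgN -avgD; apply: eq_avg => o; rewrite -mulr_suml; ring.
pose J o : R := (F o <= x)%R%:R.
have remE k o : (k < n)%N -> `|u k o * (X k.+1 o * rem k o / 2)| <=
    c k ^+ 3 * (4 * `|F o| + 2 * K) +
    4 * (c k * (X k.+1 o * D k o * (J (flip k.+1 o) - J o))).
  move=> kn; have -> : `|u k o * (X k.+1 o * rem k o / 2)| =
      `|u k o| * `|rem k o| / 2.
    rewrite normrM (normrM (X k.+1 o * _)) (normrM (X k.+1 o)) X_norm mul1r.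
    by rewrite [X in _ * (_ * X)]ger0_norm// mulrA.
  have HF := F_flip _ o kn.
  have vw : F (flip k.+1 o) - F o = - (2 * (X k.+1 o * D k o)).
    by rewrite -HF opprB.
  (* If the flip crosses [x], the change of [J] has the sign of [F o - F (flip k.+1 o)]. The
     absolute value thus becomes a product of two discrete gradients. *)
  have opp : `|F (flip k.+1 o) - F o| * ((F o <= x) != (F (flip k.+1 o) <= x))%R%:R =
      2 * (X k.+1 o * D k o * (J (flip k.+1 o) - J o)).
    rewrite mulrA -HF distrC /J.
    have [a1|a1] := leP (F o) x; have [a2|a2] := leP (F (flip k.+1 o)) x => /=.
    - by rewrite mulr0 subrr mulr0.
    - by rewrite ltr0_norm ?subr_lt0 ?(le_lt_trans a1)//; ring.
    - by rewrite gtr0_norm ?subr_gt0 ?(le_lt_trans a2)//; ring.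
    - by rewrite mulr0 subrr mulr0.
  have := gT (F o) (F (flip k.+1 o)); rewrite -/(rem k o) -mulrA opp vw.
  have -> : (- (2 * (X k.+1 o * D k o))) ^+ 2 = X k.+1 o ^+ 2 * (4 * D k o ^+ 2) by ring.
  rewrite X_sqr mul1r => H.
  have DD : D k o ^+ 2 <= c k ^+ 2.
    by rewrite -real_normK ?num_real// ler_pXn2r ?nnegrE.
  have H1 : `|u k o| * `|rem k o| <= c k * ((2 * `|F o| + K) * (4 * c k ^+ 2) +
      4 * (2 * (X k.+1 o * D k o * (J (flip k.+1 o) - J o)))).
    rewrite ler_pM// (le_trans H)// lerD2r ler_wpM2l ?addr_ge0 ?mulr_ge0//.
    by rewrite ler_wpM2l.
  rewrite ler_pdivrMr//; apply: le_trans H1 _.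
  by rewrite le_eqVlt; apply/orP; left; apply/eqP; ring.
have remS : `|avg (fun o => \sum_(k < n) u k o * (X k.+1 o * rem k o / 2))| <=
    (20 + 10 * K) * r + 12 * r.
  apply: le_trans (ler_norm_avg _) _.
  apply: (@le_trans _ _ (avg (fun o => (\sum_(k < n) c k ^+ 3) * (4 * `|F o| + 2 * K)
      + \sum_(k < n) 4 * (c k * (X k.+1 o * D k o * (J (flip k.+1 o) - J o)))))).
    apply: le_avg => o; rewrite mulr_suml -big_split/=.
    apply: le_trans (ler_norm_sum _ _ _) _; apply: ler_sum => k _.
    exact: remE.
  rewrite avgD avgZ; apply: lerD.
    rewrite avgD avgZ avg_cst//.
    have A0 : 0 <= 4 * avg (fun o => `|F o|) + 2 * K.
      by apply: addr_ge0; apply: mulr_ge0 => //; apply: avg_ge0.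
    have := ler_wpM2r A0 c3_sum; have := ler_wpM2l r0 avg_absF.
    by lra.
  (* Second integration by parts, read backwards: the gradient of [J] is traded for the factor
     [X k.+1], which assembles [W]. *)
  have -> : avg (fun o => \sum_(k < n)
      4 * (c k * (X k.+1 o * D k o * (J (flip k.+1 o) - J o)))) =
      avg (fun o => - 8 * (J o * W o)).
    pose cD k o := c k * D k o.
    have -> : avg (fun o => - 8 * (J o * W o)) =
        avg (fun o => \sum_(k < n) - 8 * (X k.+1 o * cD k o * J o)).
      apply: eq_avg => o; rewrite /W !mulr_sumr; apply: eq_bigr => k _.
      by rewrite /cD; ring.
    rewrite !avg_sum; apply: eq_bigr => k _.
    rewrite [RHS]avgZ (@avg_parts J cD)//; last by move=> o; rewrite /cD D_flip.
    by rewrite -avgZ; apply: eq_avg => o; rewrite /cD; field.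
  apply: (@le_trans _ _ (avg (fun o => 8 * `|W o|))).
    apply: le_avg => o; rewrite /J; case: (F o <= x); rewrite /= ?mul1r ?mul0r ?mulr0.
      by rewrite mulNr -mulrN ler_wpM2l// -normrN ler_norm.
    by rewrite mulr_ge0.
  by rewrite avgZ; have := avg_W; lra.
have mainS : `|avg (fun o => (1 - \sum_(k < n) u k o * D k o) * g' (F o))| <= 4 * r.
  apply: le_trans (ler_norm_avg _) _.
  apply: (@le_trans _ _ (avg (fun o => 2 * `|\sum_(k < n) u k o * D k o - 1|))).
    by apply: le_avg => o; rewrite normrM distrC mulrC ler_wpM2r.
  by rewrite avgZ; have := avg_Gamma; lra.
apply: le_trans (ler_normD _ _) _.
by have := lerD mainS remS; lra.
Qed.

End quadratic_form.
End sign_system.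

(** * The discrete cube and its Berry-Esseen bound *)

Section cube.
Context {R : realType}.

(** [inord] sends indices above [m] to coordinate 0, so different indices give different signs only
    up to [m]. *)
Definition cube_sign m (k : nat) (o : {ffun 'I_m.+1 -> bool}) : R :=
  (-1) ^+ o (inord k).

Definition cube_flip m (k : nat) (o : {ffun 'I_m.+1 -> bool}) :=
  [ffun i => o i (+) (i == inord k)].

Lemma cube_flipK m k : involutive (@cube_flip m k).
Proof. by move=> o; apply/ffunP => i; rewrite !ffunE -addbA addbb addbF. Qed.

Lemma cube_sign_flip m k o : cube_sign m k (cube_flip m k o) = - cube_sign m k o.
Proof. by rewrite /cube_sign ffunE eqxx addbT signrN. Qed.

Lemma cube_sign_flip_neq m j k o : (j < m.+1)%N -> (k < m.+1)%N -> j != k ->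
  cube_sign m j (cube_flip m k o) = cube_sign m j o.
Proof.
move=> jm km jk; rewrite /cube_sign ffunE.
by rewrite -val_eqE /= !inordK// (negbTE jk) addbF.
Qed.

Lemma cube_sign_sqr m k o : cube_sign m k o ^+ 2 = 1.
Proof. by rewrite /cube_sign sqrr_sign. Qed.

Lemma card_cube m : (0 < #|{ffun 'I_m -> bool}|)%N.
Proof. by rewrite card_ffun card_bool expn_gt0. Qed.

Definition cube_form n b := quad_form (cube_sign n.+1) n b.

Lemma avg_cube_form n b : avg (cube_form n b) = 0.
Proof.
apply: (@avg_quad_form _ _ n.+2 _ (cube_flip n.+1)).
- exact: card_cube.
- exact: cube_flipK.
- by move=> k o _; exact: cube_sign_flip.
- exact: cube_sign_flip_neq.
- by [].
Qed.

Lemma avg_sqr_cube_form n b : b 0%N = 0 ->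
  avg (fun o => cube_form n b o ^+ 2) = quad_form_var n b.
Proof.
apply: (@avg_sqr_quad_form _ _ n.+2 _ (cube_flip n.+1)).
- exact: card_cube.
- exact: cube_flipK.
- by move=> k o _; exact: cube_sign_flip.
- exact: cube_sign_flip_neq.
- exact: cube_sign_sqr.
- by [].
Qed.

Lemma cube_berry_esseen : exists2 C : R, 0 < C &
  forall n b r y, b 0%N = 0 -> 0 < quad_form_var n b -> 0 <= r ->
    r ^+ 2 = \sum_(k < n.+1) b k ^+ 4 ->
  `|avg (fun o => (cube_form n b o <= y)%R%:R) -
    normal_cdf (y / Num.sqrt (quad_form_var n b))| <= C * (r / quad_form_var n b).
Proof.
have [K K0 stein] := @normal_stein R.
exists (36 + 10 * K) => [|n b r y b0 V0 r0 rE]; first by rewrite addr_gt0 ?mulr_gt0.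
set V := quad_form_var n b in V0 *; pose sd := Num.sqrt V.
have sd0 : 0 < sd by rewrite sqrtr_gt0.
have sdE : sd ^+ 2 = V by rewrite sqr_sqrtr// ltW.
(* Rescaling to unit variance; fourth powers are divided by the squared variance, which turns [r]
   into [r / V]. *)
pose b' k := b k / sd.
have [g [g' [gE g'2 gT]]] := stein (y / sd).
have FE o : cube_form n b' o = cube_form n b o / sd.
  rewrite /cube_form /quad_form mulr_suml; apply: eq_bigr => k _.
  by rewrite /b'; field; rewrite gt_eqF.
rewrite (_ : avg _ = avg (fun o => (cube_form n b' o <= y / sd)%R%:R)); last first.
  by apply: eq_avg => o; rewrite FE ler_pM2r// invr_gt0.
apply: (@quad_form_stein_bound _ _ n.+2 _ (cube_flip n.+1) _ _ _ _ _ _ _ _ _ _ _ _ _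
   K _ _ g g') => //.
- exact: card_cube.
- exact: cube_flipK.
- by move=> k o _; exact: cube_sign_flip.
- exact: cube_sign_flip_neq.
- exact: cube_sign_sqr.
- by rewrite /b' b0 mul0r.
- by rewrite divr_ge0// ltW.
- rewrite exprMn rE -sdE mulr_suml; apply: eq_bigr => k _.
  by rewrite /b'; field; rewrite gt_eqF.
- rewrite -[RHS](divff (lt0r_neq0 V0)) -{2}sdE /V /quad_form_var mulr_suml.
  by apply: eq_bigr => k _; rewrite /b'; field; rewrite gt_eqF.
- exact: ltW.
Qed.

End cube.

(** * Partial sums of the random series *)

Lemma one_neqN1 (R : numDomainType) : (1 : R) != -1.
Proof. by rewrite -subr_eq0 opprK -mulr2n pnatr_eq0. Qed.

Section rademacher.
Context {R : realType} {d : measure_display} {T : measurableType d}.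
Variables (P : probability T R) (I : eqType) (X : I -> {RV P >-> R}).
Hypothesis hX : iid_rademacher X.

Let measurable_eq i (x : R) : measurable (X i @^-1` [set x]).
Proof.
rewrite -[X in measurable X]setTI.
by apply: (@measurable_funPT _ _ _ _ (X i) measurableT); exact: measurable_set1.
Qed.

Lemma rademacher_ae i : {ae P, forall t, X i t = 1 \/ X i t = -1}.
Proof.
have [_ /(_ i)[H1 HN1]] := hX.
pose A := [set t | X i t = 1]; pose B := [set t | X i t = -1].
have mA : measurable A by exact: measurable_eq.
have mB : measurable B by exact: measurable_eq.
exists (~` (A `|` B)); split => //.
- by apply: measurableC; exact: measurableU.
- have AB0 : A `&` B = set0.
    rewrite -subset0 => t [+ /=]; rewrite /A /B /= => -> /eqP.
    by rewrite (negbTE (one_neqN1 R)).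
  rewrite probability_setC; last exact: measurableU.
  have -> : P (A `|` B) = (P A + P B)%E by rewrite measureU.
  have -> : P A = (1 / 2)%:E by rewrite div1r; exact: H1.
  have -> : P B = (1 / 2)%:E by rewrite div1r; exact: HN1.
  by rewrite -EFinD -splitr subrr.
Qed.

Variables (m : nat) (iota : 'I_m -> I).
Hypothesis iota_inj : injective iota.

Let atom (o : {ffun 'I_m -> bool}) : set T :=
  [set t | forall j, X (iota j) t = (-1) ^+ o j].

(** Independence speaks of sets indexed by all of [I]: [pick] inverts [iota], and 1 is a default off
    its range. *)
Let atomE o : atom o = \bigcap_(i in [set` [seq iota j | j <- enum 'I_m]])
  (X i @^-1` [set if [pick j | iota j == i] is Some j then (-1) ^+ o j else 1]).
Proof.
have pickE j : [pick j' | iota j' == iota j] = Some j.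
  by case: pickP => [j' /eqP/iota_inj->//|/(_ j)]; rewrite eqxx.
apply/seteqP; split => t /= H.
  by move=> _ /= /mapP[j _ ->] /=; rewrite pickE.
by move=> j; have := H (iota j); rewrite /= pickE; apply; rewrite map_f ?mem_enum.
Qed.

Let measurable_atom o : measurable (atom o).
Proof.
rewrite atomE; apply: fin_bigcap_measurable => // i _.
Qed.

Let prob_atom o : P (atom o) = (#|{ffun 'I_m -> bool}|%:R^-1)%:E.
Proof.
have [indep half] := hX.
rewrite atomE indep//; last by rewrite map_inj_uniq ?enum_uniq.
rewrite big_map.
have E j : P (X (iota j) @^-1` [set if [pick j' | iota j' == iota j] is Some j'
     then (-1) ^+ o j' else 1]) = (2^-1)%:E.
  have [H1 HN1] := half (iota j).
  by case: pickP => [j' _|_]//; case: (o j').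
under eq_bigr do rewrite E.
rewrite prodEFin big_enum/= prodr_const card_ffun card_bool card_ord natrX.
by rewrite exprVn.
Qed.

(** Bridge from [P] to the cube: almost surely exactly one atom occurs, and all atoms have the same
    mass. [h] is prescribed on the atoms only, the rest being a null set. *)
Lemma integral_signs (h : T -> R) (g : {ffun 'I_m -> bool} -> R) :
  measurable_fun [set: T] h ->
  (forall (o : {ffun 'I_m -> bool}) t,
    (forall j, X (iota j) t = (-1) ^+ o j) -> h t = g o) ->
  (\int[P]_t (h t)%:E = (avg g)%:E)%E.
Proof.
move=> mh hg.
have ae_h : ae_eq P [set: T] (EFin \o h)
    (fun t => \sum_o (g o * \1_(atom o) t)%:E)%E.
  have : {ae P, forall t (j : 'I_m), X (iota j) t = 1 \/ X (iota j) t = -1}.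
    by apply: filter_forall => j; exact: rademacher_ae.
  apply: filterS => t Ht _ /=.
  pose o := [ffun j => X (iota j) t == -1].
  have to : atom o t.
    move=> j; rewrite ffunE.
    by have [->|->] := Ht j; rewrite ?eqxx// (negbTE (one_neqN1 R)).
  rewrite (hg o t to) (bigD1 o)//= big1 ?adde0.
    by rewrite indicE mem_set ?mulr1.
  move=> o' oo'; rewrite indicE memNset ?mulr0// => to'.
  move/negP: oo'; apply; apply/eqP/ffunP => j.
  by apply: (@signr_inj R); rewrite -to -to'.
rewrite (ae_eq_integral _ _ _ _ _ ae_h)//; last 2 first.
- exact/measurable_EFinP.
- apply: emeasurable_sum => o; apply/measurable_EFinP.
  by apply: measurable_funM; [exact: measurable_cst|exact: measurable_indic].
rewrite integral_sum//; last first.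
  move=> o; under eq_fun do rewrite EFinM.
  apply: integrableZl => //.
  by apply: integrable_indic.
rewrite /avg mulr_sumr -sumEFin; apply: eq_bigr => o _.
under eq_integral do rewrite EFinM.
rewrite integralZl//; last exact: integrable_indic.
by rewrite integral_indic// setIT mulrC EFinM; congr (_ * _)%E; exact: prob_atom.
Qed.

End rademacher.

(** Regrouping from vertices to edges by an index shift; the vanishing end weights absorb the
    boundary terms. *)
Lemma quad_form_edges (R : realType) (O : finType) (X : nat -> O -> R) m b o :
  b 0%N = 0 -> b m.+1 = 0 -> quad_form X m.+1 b o =
  \sum_(k < m) b k.+1 * (X k.+1 o * X k.+2 o - X k.+1 o - X k.+2 o) / 4.
Proof.
move=> b0 bm; rewrite /quad_form.
have -> : \sum_(k < m.+1) X k.+1 o * ((- (b k + b k.+1) + b k.+1 * X k.+2 o) / 4) =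
  \sum_(k < m.+1) b k.+1 * (X k.+1 o * X k.+2 o - X k.+1 o) / 4 -
  \sum_(k < m.+1) b k * X k.+1 o / 4.
  by rewrite -sumrB; apply: eq_bigr => k _; field.
rewrite big_ord_recr/= bm mul0r mul0r addr0 big_ord_recl/= b0 mul0r mul0r add0r.
by rewrite -sumrB; apply: eq_bigr => k _; rewrite /bump/= add1n; field.
Qed.

(** * Transfer of the cube estimates to the partial sums *)

Section partial_sums.
Context {R : realType} {d : measure_display} {T : measurableType d}.
Variables (P : probability T R) (X : int -> {RV P >-> R}).
Hypothesis hX : iid_rademacher X.
Variables (a : int -> R) (p q : nat).

Let m := (p + q).+1.

(* Vertex [j] of the cube stands for the integer [j - 1 - p], and [edge_coef k]
   weights the edge between vertices [k] and [k.+1]; the edges at both ends are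
   padding, so that every vertex carrying a nonzero weight has two neighbours. *)
Definition edge_coef (k : nat) : R :=
  if (0 < k <= m)%N then a (k%:Z - 1 - p%:Z) else 0.

Definition partial_sum_var : R := quad_form_var m.+1 edge_coef.

Local Notation F := (bilateral_partial_sum (centred_summand X a) p q).

Lemma edge_coefS (k : 'I_m) : edge_coef k.+1 = a (k%:Z - p%:Z).
Proof.
by rewrite /edge_coef /= ltn_ord; congr (a _); rewrite intS; ring.
Qed.

Let iota (j : 'I_m.+3) : int := j%:Z - 1 - p%:Z.

Let iota_inj : injective iota.
Proof. by move=> i j /addIr/addIr[] /val_inj. Qed.

(** For neighbours [X] and [X'], [Y * Y' - 4^-1] equals [(X * X' - X - X') / 4], the edge term of
    the form. *)
Lemma partial_sum_cube (o : {ffun 'I_m.+3 -> bool}) t :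
  (forall j, X (iota j) t = (-1) ^+ o j) -> F t = cube_form m.+1 edge_coef o.
Proof.
move=> Xo; rewrite /cube_form quad_form_edges; last 2 first.
- by [].
- by rewrite /edge_coef ltnn andbF.
apply: eq_bigr => k _; rewrite edge_coefS.
have E j : (j < m.+3)%N -> cube_sign m.+2 j o = X (j%:Z - 1 - p%:Z) t.
  by move=> jm; rewrite /cube_sign -Xo /iota inordK.
have km := ltn_ord k.
rewrite (E k.+1) ?(E k.+2) ?ltnS ?(leqW (ltnW km)) ?(ltnW km)//.
rewrite /centred_summand /Y.
have -> : k.+1%:Z - 1 - p%:Z = k%:Z - p%:Z by rewrite intS; ring.
have -> : k.+2%:Z - 1 - p%:Z = k%:Z - p%:Z + 1 by rewrite !intS; ring.
by field.
Qed.

Lemma measurable_partial_sum : measurable_fun [set: T] F.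
Proof.
have mY i : measurable_fun [set: T] (Y X i).
  apply: measurable_funM; first exact: measurable_cst.
  by apply: measurable_funB; [exact: measurable_cst|exact: measurable_funPT].
apply: measurable_sum => k; apply: measurable_funM; first exact: measurable_cst.
apply: measurable_funB; last exact: measurable_cst.
exact: measurable_funM.
Qed.

Lemma integral_partial_sum : (\int[P]_t (F t)%:E = 0)%E.
Proof.
rewrite (integral_signs _ _ _ hX _ _ iota_inj _ (cube_form m.+1 edge_coef)).
- by rewrite avg_cube_form.
- exact: measurable_partial_sum.
- exact: partial_sum_cube.
Qed.

Lemma integral_sqr_partial_sum :
  (\int[P]_t (F t ^+ 2)%:E = partial_sum_var%:E)%E.
Proof.
rewrite (integral_signs _ _ _ hX _ _ iota_inj _
   (fun o => cube_form m.+1 edge_coef o ^+ 2)).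
- by rewrite avg_sqr_cube_form.
- by apply: measurable_funX; exact: measurable_partial_sum.
- by move=> o t Xo; rewrite (partial_sum_cube o).
Qed.

Lemma prob_partial_sum y : P [set t | F t <= y] =
  (avg (fun o => (cube_form m.+1 edge_coef o <= y)%R%:R))%:E.
Proof.
have mF : measurable [set t | F t <= y].
  have -> : [set t | F t <= y] = [set: T] `&` (F @^-1` `]-oo, y]).
    by rewrite setTI; apply/seteqP; split => t /=; rewrite in_itv.
  exact: measurable_partial_sum.
rewrite -[LHS]/(P _) -(setIT [set t | F t <= y]) -integral_indic//.
rewrite (integral_signs _ _ _ hX _ _ iota_inj _
   (fun o => (cube_form m.+1 edge_coef o <= y)%R%:R)) //.
move=> o t Xo; rewrite indicE -(partial_sum_cube o t)//.
by congr (nat_of_bool _)%:R; apply/idP/idP; rewrite inE.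
Qed.

(** A single term of the variance already contains the square of this weight; the bound keeps the
    limiting variance away from 0. *)
Lemma partial_sum_var_ge (i : int) : - p%:Z <= i <= q%:Z ->
  a i ^+ 2 / 16 <= partial_sum_var.
Proof.
move=> /andP[pi' iq].
have [k kE] : exists k : nat, i + p%:Z = k%:Z.
  by exists (absz (i + p%:Z)); rewrite gez0_abs//; lia.
have km : (k < m)%N by rewrite /m; lia.
have -> : a i = edge_coef k.+1.
  by rewrite (edge_coefS (Ordinal km))/= -kE addrK.
have km1 : (k < m.+1)%N by rewrite ltnW.
rewrite /partial_sum_var /quad_form_var (bigD1 (Ordinal km1))//=.
rewrite ler_wpDr//; last by rewrite ler_pM2r// lerDr sqr_ge0.
by apply: sumr_ge0 => j _; rewrite divr_ge0// addr_ge0// sqr_ge0.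
Qed.

Lemma sum_edge_coef4 : ((\sum_(k < m.+2) edge_coef k ^+ 4)%:E <=
  \esum_(i in [set: int]) (a i ^+ 4)%:E)%E.
Proof.
have b0 : edge_coef 0 = 0 by [].
have bm : edge_coef m.+1 = 0 by rewrite /edge_coef ltnn andbF.
rewrite big_ord_recl big_ord_recr/= b0 /bump/= add1n bm !expr0n/= add0r addr0.
pose J := [seq k%:Z - p%:Z | k <- index_iota 0 m].
have uJ : uniq J.
  by rewrite map_inj_uniq ?iota_uniq// => i j /addIr[].
apply: esum_ge; exists [set` J]; first by split; [exact: finite_seq|].
rewrite -fsbig_seq//= big_map -sumEFin big_mkord.
by apply: lee_sum => k _; rewrite edge_coefS.
Qed.

End partial_sums.

(** * Passage to the limit in L2 *)

Section L2.
Context {R : realType} {d : measure_display} {T : measurableType d}.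
Variable P : probability T R.
Implicit Types f g : T -> R.

(** [fine] maps an infinite norm to 0, hence the membership conditions in [Lfun] below. *)
Definition norm2 f : R := fine 'N[P]_2%:E[EFin \o f]%E.

Lemma norm2_ge0 f : 0 <= norm2 f.
Proof. by rewrite fine_ge0// Lnorm_ge0. Qed.

Lemma norm2_fin f : f \in Lfun P 2%:E -> ('N[P]_2%:E[EFin \o f] = (norm2 f)%:E)%E.
Proof.
rewrite inE => /andP[_]; rewrite inE/= => fin.
by rewrite fineK// ge0_fin_numE ?Lnorm_ge0.
Qed.

Lemma Lnorm2_sqr f :
  ('N[P]_2%:E[EFin \o f] `^ 2 = \int[P]_t (f t ^+ 2)%:E)%E.
Proof.
rewrite poweR_Lnorm//; apply: eq_integral => t _ /=.
by rewrite powR_mulrn// real_normK ?num_real.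
Qed.

Lemma integral_sqr f : f \in Lfun P 2%:E ->
  (\int[P]_t (f t ^+ 2)%:E = (norm2 f ^+ 2)%:E)%E.
Proof.
move=> fL; rewrite -Lnorm2_sqr norm2_fin// poweR_EFin powR_mulrn// norm2_ge0//.
Qed.

Lemma Lfun2P f : measurable_fun [set: T] f ->
  (\int[P]_t (f t ^+ 2)%:E < +oo)%E -> f \in Lfun P 2%:E.
Proof.
move=> mf; rewrite -Lnorm2_sqr => fin.
rewrite inE; apply/andP; split; rewrite inE//=.
by rewrite /finite_norm; apply: lty_poweRy fin.
Qed.

Lemma Lfun2D f g : f \in Lfun P 2%:E -> g \in Lfun P 2%:E -> f \+ g \in Lfun P 2%:E.
Proof.
by have [_] := @Lfun_addr_closed _ _ _ P 2%:E (lee1n 2); apply.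
Qed.

Lemma Lfun2N f : f \in Lfun P 2%:E -> \- f \in Lfun P 2%:E.
Proof. by move=> fL; apply: (Lfun_oppr_closed fL). Qed.

Lemma norm2N f : norm2 (\- f) = norm2 f.
Proof.
rewrite /norm2; congr fine; rewrite -[RHS]oppe_Lnorm; congr Lnorm.
Qed.

Lemma ler_norm2D f g : f \in Lfun P 2%:E -> g \in Lfun P 2%:E ->
  norm2 (f \+ g) <= norm2 f + norm2 g.
Proof.
move=> fL gL; rewrite -lee_fin EFinD -!norm2_fin ?Lfun2D//.
apply: eminkowski; last by rewrite lee1n.
- by move: fL; rewrite inE => /andP[]; rewrite inE.
- by move: gL; rewrite inE => /andP[]; rewrite inE.
Qed.

Lemma norm2_dist f g : f \in Lfun P 2%:E -> g \in Lfun P 2%:E ->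
  `|norm2 f - norm2 g| <= norm2 (f \- g).
Proof.
move=> fL gL.
have fgL : f \- g \in Lfun P 2%:E by apply: Lfun2D => //; exact: Lfun2N.
have H1 := ler_norm2D _ _ fgL gL.
have H2 := ler_norm2D _ _ (Lfun2N _ fgL) fL.
rewrite norm2N in H2.
have E1 : (f \- g) \+ g = f by apply/funext => t /=; rewrite subrK.
have E2 : \- (f \- g) \+ f = g by apply/funext => t /=; rewrite opprB subrK.
by rewrite E1 in H1; rewrite E2 in H2; rewrite ler_norml; lra.
Qed.

Lemma Lfun2_Lfun1 f : f \in Lfun P 2%:E -> f \in Lfun P 1.
Proof. by move=> fL; apply: Lfun_subset12 fL; rewrite fin_num_measure. Qed.

Lemma varianceE2 f : f \in Lfun P 2%:E ->
  fine 'V_P[f] = norm2 f ^+ 2 - fine 'E_P[f] ^+ 2.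
Proof.
move=> fL; rewrite varianceE//.
have -> : ('E_P[f ^+ 2] = (norm2 f ^+ 2)%:E)%E.
  by rewrite unlock -integral_sqr//.
by rewrite -(fineK (expectation_fin_num (Lfun2_Lfun1 _ fL))).
Qed.

Lemma mean_sqr_le f : f \in Lfun P 2%:E -> fine 'E_P[f] ^+ 2 <= norm2 f ^+ 2.
Proof.
by move=> fL; rewrite -subr_ge0 -varianceE2// fine_ge0// variance_ge0.
Qed.

(** Chebyshev's inequality, from Markov's with the square function. *)
Lemma prob_norm_ge (f : {RV P >-> R}) (e : R) : 0 < e ->
  (f : T -> R) \in Lfun P 2%:E ->
  fine (P [set t | e <= `|f t|]) <= norm2 f ^+ 2 / e ^+ 2.
Proof.
move=> e0 fL; rewrite ler_pdivlMr ?exprn_gt0// mulrC.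
have := @markov _ _ _ P f (fun x => x ^+ 2) e e0 (exprn_measurable _) _ _.
move=> /(_ (fun r _ => sqr_ge0 r)).
have h : {in Num.nneg &, {homo (fun x : R => x ^+ 2) : x y / x <= y}}.
  by move=> x y; rewrite !nnegrE => x0 y0 xy; rewrite ler_pXn2r.
move=> /(_ h).
have -> : ('E_P[(fun x : R => x ^+ 2)%R \o (fun x : R => `|x|%R) \o f] =
    (norm2 f ^+ 2)%:E)%E.
  rewrite unlock -integral_sqr//; apply: eq_integral => t _ /=.
  by rewrite real_normK ?num_real.
have -> : [set x | (e%:E <= `|(f x)%:E|)%E] = [set t | e <= `|f t|].
  by apply/seteqP; split => t /=; rewrite lee_fin.
have mA : measurable [set t | e <= `|f t|].
  have -> : [set t | e <= `|f t|] = [set: T] `&` ((fun t => `|f t|) @^-1` `[e, +oo[).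
    by rewrite setTI; apply/seteqP; split => t /=; rewrite in_itv/= andbT.
  by have /(_ measurableT) := measurableT_comp (@normr_measurable R setT)
    (@measurable_funPT _ _ _ _ f); apply.
by rewrite -[P _]fineK ?fin_num_measure// -EFinM lee_fin.
Qed.

(** If [f <= y], then [h <= y + e] or [f] and [h] differ by at least [e]; Chebyshev bounds the
    second event. *)
Lemma prob_le_shift f h (y e : R) : 0 < e ->
  measurable_fun [set: T] f -> measurable_fun [set: T] h -> f \- h \in Lfun P 2%:E ->
  fine (P [set t | f t <= y]) <=
  fine (P [set t | h t <= y + e]) + norm2 (f \- h) ^+ 2 / e ^+ 2.
Proof.
move=> e0 mf mh fhL.
have mfh : measurable_fun [set: T] (f \- h) by exact: measurable_funB.
pose D : {RV P >-> R} := HB.pack_for {mfun T >-> R} (f \- h)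
  (isMeasurableFun.Build _ _ _ _ (f \- h) mfh).
have mle (k : T -> R) (z : R) : measurable_fun [set: T] k ->
    measurable [set t | k t <= z].
  move=> mk; have -> : [set t | k t <= z] = [set: T] `&` (k @^-1` `]-oo, z]).
    by rewrite setTI; apply/seteqP; split => t /=; rewrite in_itv.
  exact: mk.
have mD : measurable [set t | e <= `|D t|].
  have -> : [set t | e <= `|D t|] = [set: T] `&` ((fun t => `|D t|) @^-1` `[e, +oo[).
    by rewrite setTI; apply/seteqP; split => t /=; rewrite in_itv/= andbT.
  by have /(_ measurableT) := measurableT_comp (@normr_measurable R setT) mfh; apply.
apply: le_trans (lerD (lexx _) (prob_norm_ge D e e0 fhL)).
have mf' := mle f y mf; have mh' := mle h (y + e) mh.
rewrite -fineD ?fin_num_measure//.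
rewrite fine_le ?fin_numD ?fin_num_measure//.
apply: le_trans (measureU2 P mh' mD).
apply: le_measure; rewrite ?inE//; first exact: measurableU.
move=> t /= fy; have [hy|hy] := leP (h t) (y + e); [by left|right].
have : h t - f t <= `|f t - h t| by rewrite distrC ler_norm.
by apply: le_trans; move: fy hy; lra.
Qed.

End L2.

(** * The Berry-Esseen bound for the L2 limit *)

Section bilateral_sum_limit.
Context {R : realType} {d : measure_display} {T : measurableType d}.
Variables (P : probability T R) (X : int -> {RV P >-> R}).
Hypothesis hX : iid_rademacher X.
Variables (a : int -> R) (G : {RV P >-> R}).
Hypothesis hG : is_L2_bilateral_sum (centred_summand X a) G.
Hypothesis a_neq0 : exists i, a i != 0.

Let F N := bilateral_partial_sum (centred_summand X a) N N.
Let v N := partial_sum_var a N N.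

Let F_meas N : measurable_fun [set: T] (F N).
Proof. exact: measurable_partial_sum. Qed.

Let F_Lfun N : F N \in Lfun P 2%:E.
Proof. by apply: Lfun2P => //; rewrite integral_sqr_partial_sum// ltry. Qed.

Let norm2_F N : norm2 P (F N) ^+ 2 = v N.
Proof.
by apply/EFin_inj; rewrite -integral_sqr// integral_sqr_partial_sum.
Qed.

Let cvg_dist : 'N[P]_2%:E[EFin \o (G \- F N)%R]%E @[N --> \oo] --> 0%E.
Proof.
have pairN : (fun N : nat => (N, N)) @ \oo --> filter_prod \oo \oo.
  move=> A [[B C] /= [nB nC] BCA]; rewrite /nbhs/=.
  by apply: filterS2 nB nC => N BN CN; exact: BCA.
exact: (cvg_comp _ _ pairN hG).
Qed.

Let dist_cvg0 : norm2 P (G \- F N) @[N --> \oo] --> (0 : R).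
Proof. by have /fine_cvgP[] := cvg_dist. Qed.

(** Convergence to 0 forces the norm of [G \- F N] to be finite for some [N], and [F N] is square
    integrable. *)
Let G_Lfun : (G : T -> R) \in Lfun P 2%:E.
Proof.
have /fine_cvgP[+ _] := cvg_dist => -[N _ /(_ N (leqnn N))/= fin].
have -> : (G : T -> R) = (G \- F N) \+ F N by apply/funext => t /=; rewrite subrK.
apply: Lfun2D => //; rewrite inE; apply/andP; split; rewrite inE/=.
  by apply: measurable_funB.
by rewrite /finite_norm ltey_eq fin.
Qed.

Let dist_Lfun N : G \- F N \in Lfun P 2%:E.
Proof. by apply: Lfun2D => //; exact: Lfun2N. Qed.

Let g := norm2 P G.

Let norm2_F_cvg : norm2 P (F N) @[N --> \oo] --> g.
Proof.
apply/cvgrPdist_le => e e0; have /cvgrPdist_le/(_ e e0) := dist_cvg0.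
apply: filterS => N; rewrite sub0r normrN ger0_norm ?norm2_ge0//.
by apply: le_trans; exact: norm2_dist.
Qed.

(** The partial sums are centred, so the mean of [G] is that of [G \- F N], at most its L2 norm in
    absolute value. *)
Let mean_G : fine 'E_P[G] = 0.
Proof.
have H N : fine 'E_P[G] ^+ 2 <= norm2 P (G \- F N) ^+ 2.
  have -> : ('E_P[G] = 'E_P[(G \- F N)%R])%E.
    rewrite expectationB ?Lfun2_Lfun1//.
    have -> : ('E_P[F N] = 0)%E by rewrite unlock; exact: integral_partial_sum.
    by rewrite sube0.
  exact: mean_sqr_le.
have c : norm2 P (G \- F N) ^+ 2 @[N --> \oo] --> (0 : R).
  have := cvg_comp _ _ dist_cvg0 (@exprn_continuous R 2 0).
  by rewrite expr0n.
have : fine 'E_P[G] ^+ 2 <= 0 by apply: (cvgr_to_ge c); near=> N.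
by rewrite le_eqVlt ltNge sqr_ge0 orbF sqrf_eq0 => /eqP.
Unshelve. all: by end_near. Qed.

Let variance_G : fine 'V_P[G] = g ^+ 2.
Proof. by rewrite varianceE2// mean_G expr0n subr0. Qed.

(** One nonzero [a i] bounds the norm of [F N] below by [|a i| / 4] as soon as [N] reaches [|i|]. *)
Let g_gt0 : 0 < g.
Proof.
have [i ai] := a_neq0.
apply: (@lt_le_trans _ _ (`|a i| / 4)); first by rewrite divr_gt0 ?normr_gt0.
apply: (cvgr_to_ge norm2_F_cvg).
near=> N.
rewrite -(@ler_pXn2r _ 2)// ?nnegrE ?norm2_ge0 ?divr_ge0// norm2_F.
have -> : (`|a i| / 4) ^+ 2 = a i ^+ 2 / 16.
  by rewrite exprMn real_normK ?num_real//; field.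
apply: partial_sum_var_ge.
have : (absz i <= N)%N by near: N; exact: nbhs_infty_ge.
by lia.
Unshelve. all: by end_near. Qed.

Lemma variance_bilateral_sum_gt0 : 0 < fine 'V_P[G].
Proof. by rewrite variance_G exprn_gt0. Qed.

(** The cube estimate enters as a hypothesis, so that one [C], fixed beforehand, serves every
    sequence. *)
Variables (C rho : R).
Hypothesis C_gt0 : 0 < C.
Hypothesis rho_ge0 : 0 <= rho.
Hypothesis a4_le : (\esum_(i in [set: int]) (a i ^+ 4)%:E <= (rho ^+ 2)%:E)%E.
Hypothesis berry_esseen : forall n b r y, b 0%N = 0 -> 0 < quad_form_var n b ->
  0 <= r -> r ^+ 2 = \sum_(k < n.+1) b k ^+ 4 ->
  `|avg (fun o => (cube_form n b o <= y)%R%:R) -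
    normal_cdf (y / Num.sqrt (quad_form_var n b))| <= C * (r / quad_form_var n b).

Let F_berry_esseen N y : 0 < norm2 P (F N) ->
  `|fine (P [set t | F N t <= y]) - normal_cdf (y / norm2 P (F N))| <=
  C * (rho / norm2 P (F N) ^+ 2).
Proof.
move=> n0; have v0 : 0 < v N by rewrite -norm2_F exprn_gt0.
pose S4 := \sum_(k < (N + N).+3) edge_coef a N N k ^+ 4.
have S40 : 0 <= S4 by apply: sumr_ge0 => k _; rewrite exprn_even_ge0.
rewrite prob_partial_sum//=.
have := @berry_esseen _ (edge_coef a N N) (Num.sqrt S4) y erefl v0 (sqrtr_ge0 _)
  (sqr_sqrtr S40).
rewrite -/(partial_sum_var a N N) -/(v N) -norm2_F sqrtr_sqr.
rewrite (ger0_norm (norm2_ge0 P (F N))).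
move=> /le_trans; apply.
rewrite ler_wpM2l ?(ltW C_gt0)// ler_wpM2r ?invr_ge0 ?sqr_ge0//.
rewrite -(@ler_pXn2r _ 2)// ?nnegrE ?sqrtr_ge0// sqr_sqrtr// -lee_fin.
by apply: le_trans a4_le; exact: sum_edge_coef4.
Qed.

Let norm2_F_gt0 : \forall N \near \oo, 0 < norm2 P (F N).
Proof. by move/cvgr_gt : norm2_F_cvg; apply. Qed.

Let error_cvg (e : R) :
  C * (rho / norm2 P (F N) ^+ 2) + norm2 P (G \- F N) ^+ 2 / e ^+ 2
    @[N --> \oo] --> C * (rho / g ^+ 2).
Proof.
rewrite -[X in _ --> X]addr0; apply: cvgD.
  apply: cvgMr; apply: cvgMr; apply: cvgV; first by rewrite expf_neq0// gt_eqF.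
  exact: (cvg_comp _ _ norm2_F_cvg (@exprn_continuous R 2 g)).
have := cvg_comp _ _ dist_cvg0 (@exprn_continuous R 2 0).
rewrite expr0n => H; rewrite -[X in _ --> X](mul0r (e ^- 2)).
exact: cvgMl.
Qed.

Let cdf_cvg (z : R) : normal_cdf (z / norm2 P (F N)) @[N --> \oo] --> normal_cdf (z / g).
Proof.
have H : z / norm2 P (F N) @[N --> \oo] --> z / g.
  by apply: cvgMr; apply: cvgV => //; rewrite gt_eqF.
exact: (cvg_comp _ _ H (@continuous_normal_cdf R (z / g))).
Qed.

(** The shift [e] stays fixed while [N] grows, so the Chebyshev term vanishes; [e] tends to 0 only
    afterwards. *)
Let upper (y e : R) : 0 < e ->
  fine (P [set t | G t <= y]) <= normal_cdf ((y + e) / g) + C * (rho / g ^+ 2).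
Proof.
move=> e0; apply: (cvgr_to_ge (cvgD (cdf_cvg (y + e)) (error_cvg e))).
near=> N; have n0 : 0 < norm2 P (F N) by near: N.
have H1 := @prob_le_shift _ _ _ P G (F N) y e e0 (@measurable_funPT _ _ _ _ G)
  (F_meas N) (dist_Lfun N).
have := @F_berry_esseen N (y + e) n0; rewrite ler_norml => /andP[_ H2].
by rewrite !fctE; lra.
Unshelve. all: by end_near. Qed.

Let lower (y e : R) : 0 < e ->
  normal_cdf ((y - e) / g) - C * (rho / g ^+ 2) <= fine (P [set t | G t <= y]).
Proof.
move=> e0; apply: (cvgr_to_le (cvgB (cdf_cvg (y - e)) (error_cvg e))).
near=> N; have n0 : 0 < norm2 P (F N) by near: N.
have FG : F N \- G \in Lfun P 2%:E by apply: Lfun2D => //; exact: Lfun2N.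
have H1 := @prob_le_shift _ _ _ P (F N) G (y - e) e e0
  (F_meas N) (@measurable_funPT _ _ _ _ G) FG.
have nE : norm2 P (F N \- G) = norm2 P (G \- F N).
  rewrite -norm2N; congr norm2; apply/funext => t /=; exact: opprB.
rewrite nE subrK in H1.
have := @F_berry_esseen N (y - e) n0; rewrite ler_norml => /andP[H2 _].
by rewrite !fctE; lra.
Unshelve. all: by end_near. Qed.

Lemma bilateral_sum_berry_esseen x :
  `|fine (P [set t | centred_over_sd G t <= x]) - normal_cdf x| <=
  C * (rho / fine 'V_P[G]).
Proof.
rewrite variance_G.
have -> : [set t | centred_over_sd G t <= x] = [set t | G t <= x * g].
  apply/seteqP; split => t /=; rewrite /centred_over_sd variance_G sqrtr_sqr;
  by rewrite (gtr0_norm g_gt0) ler_pdivrMr.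
(* Continuity of the normal distribution function removes the shift; [s] is -1 for the lower bound
   and 1 for the upper one. *)
have lim (s : R) : normal_cdf ((x * g + s * e) / g) @[e --> 0^'+] --> normal_cdf x.
  have e_cvg : e @[e --> 0^'+] --> (0 : R) by exact: cvg_at_right_filter cvg_id.
  have H : (x * g + s * e) / g @[e --> 0^'+] --> (x * g + s * 0) / g.
    by apply: cvgMl; apply: cvgD; [exact: cvg_cst|exact: cvgMr].
  rewrite mulr0 addr0 mulfK ?gt_eqF// in H.
  exact: (cvg_comp _ _ H (@continuous_normal_cdf R x)).
rewrite ler_distl; apply/andP; split.
  rewrite lerBlDr; apply: (cvgr_to_le (lim (-1))); near=> e.
  have e0 : 0 < e by near: e; exact: nbhs_right_gt.
  by have := lower (x * g) e e0; rewrite mulN1r; lra.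
rewrite -lerBlDr; apply: (cvgr_to_ge (lim 1)); near=> e.
have e0 : 0 < e by near: e; exact: nbhs_right_gt.
by have := upper (x * g) e e0; rewrite mul1r; lra.
Unshelve. all: by end_near. Qed.

End bilateral_sum_limit.

Theorem theorem6p1 (R : realType)
  (d : measure_display) (T : measurableType d) (P : probability T R)
  (X : int -> {RV P >-> R}) (hX : iid_rademacher X)
  (a : nat -> int -> R)
  (ha2 : forall n, square_summable (a n))
  (ha0 : forall n, exists i, a n i != 0)
  (* Gc n is G_n - E G_n *)
  (Gc : nat -> {RV P >-> R})
  (hG : forall n, is_L2_bilateral_sum (centred_summand X (a n)) (Gc n))
  (d' : measure_display) (T' : measurableType d') (Q : probability T' R)
  (N : {RV Q >-> R}) (hN : standard_gaussian N) :
  exists C : R, 0 < C /\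
    forall n,
      let V : R := fine 'V_P[Gc n] in
      (kolmogorov_distance P Q (centred_over_sd (Gc n)) N <=
        C%:E * maxe
          ((V `^ (- (3 / 2)))%R%:E *
             \esum_(i in [set: int]) (`|a n i| ^+ 3)%R%:E)
          ((V^-1)%R%:E *
             (\esum_(i in [set: int]) (a n i ^+ 4)%R%:E) `^ (1 / 2)))%E.
Proof.
have [C C0 CBE] := @cube_berry_esseen R; exists C; split => // n; cbv zeta.
set V := fine 'V_P[Gc n]%E.
have V0 : 0 < V by exact: (variance_bilateral_sum_gt0 _ _ hX _ _ (hG n) (ha0 n)).
set A := (X in (C%:E * maxe X _)%E); set A4 := (X in (X `^ (1 / 2))%E).
(* The second entry of the maximum alone is reached. *)
apply: (@le_trans _ _ (C%:E * ((V^-1)%:E * A4 `^ (1 / 2)))%E); last first.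
  by rewrite lee_pmul2l ?lte_fin// le_max lexx orbT.
have A40 : (0 <= A4)%E by apply: esum_ge0 => i _; rewrite lee_fin exprn_even_ge0.
(* An infinite sum would make the right-hand side infinite, as [C] and [V^-1] are positive. *)
have [A4y|A4fin] := eqVneq A4 +oo%E.
  by rewrite A4y poweRyr ?gt0_muley ?lte_fin ?invr_gt0 ?leey// lt0r_neq0// divr_gt0.
pose rho := Num.sqrt (fine A4).
have fA40 : 0 <= fine A4 by exact: fine_ge0.
have A4E : A4 = (rho ^+ 2)%:E.
  by rewrite sqr_sqrtr// fineK// ge0_fin_numE// ltey.
have -> : (A4 `^ (1 / 2) = rho%:E)%E.
  rewrite A4E poweR_EFin -powR_mulrn ?sqrtr_ge0// -powRrM.
  by rewrite div1r divff ?powRr1 ?sqrtr_ge0.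
apply: ge_ereal_sup => _ [x _ <-].
have H := @bilateral_sum_berry_esseen _ _ _ _ _ hX _ _ (hG n) (ha0 n) C rho C0
  (sqrtr_ge0 _) _ CBE x.
rewrite -/A4 -A4E lexx -/V in H; have {}H := H isT.
have -> : Q [set t | N t <= x] = (normal_cdf x)%:E.
  have := hN `]-oo, x]%classic (measurable_itv _).
  by rewrite /normal_cdf fineK ?fin_num_measure.
have mF : measurable [set t | centred_over_sd (Gc n) t <= x].
  have -> : [set t | centred_over_sd (Gc n) t <= x] =
      [set: T] `&` (centred_over_sd (Gc n) @^-1` `]-oo, x]).
    by rewrite setTI; apply/seteqP; split => t /=; rewrite in_itv.
  apply: measurable_funM => //; exact: measurable_cst.
rewrite -[P [set t | _]]fineK ?fin_num_measure// -EFinB -EFinM lee_fin.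
by rewrite [V^-1 * _]mulrC; exact: H.
Qed.
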